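(* Consider the online fractional matching problem on $3$-uniform hypergraphs under vertex arrivals. There is a deterministic fractional algorithm that is $\frac{e-1}{e+1}$-competitive. Furthermore, every algorithm (deterministic or randomized) is at most $\frac{e-1}{e+1}$-competitive; that is, if a fractional algorithm is $\rho$-competitive for this problem, then $\rho\le \frac{e-1}{e+1}$.
   Context: An instance is a finite $3$-uniform hypergraph $\mathcal H=(V,W,H)$, where $V$ is the set of offline nodes (known in advance), $W=(w_1,w_2,\dots)$ is a finite sequence of online nodes, and every hyperedge $h\in H$ contains exactly one node of $W$ and exactly two nodes of $V$. The online nodes arrive in the order $w_1,w_2,\dots$. When $w\in W$ arrives, the set $\delta(w)$ of hyperedges containing $w$ is revealed, and the algorithm must immediately and irrevocably assign a value $x_h\ge 0$ to every $h\in\delta(w)$, without knowledge of future arrivals. At all times $x$ must be a fractional matching: $x(\delta(v))=\sum_{h\in\delta(v)}x_h\le 1$ for every $v\in V\cup W$, where $\delta(v)$ is the set of (revealed) hyperedges containing $v$. The value of an algorithm $\mathcal A$ on $\mathcal H$ is $\mathcal V(\mathcal A,\mathcal H)=\sum_{h\in H}x_h$ (its expectation, if $\mathcal A$ is randomized; the instance is then fixed independently of the random choices of $\mathcal A$). Let $\mathsf{OPT_{LP}}(\mathcal H)=\max\{\sum_{h\in H}x_h : x\ge 0,\ \sum_{h\in\delta(v)}x_h\le 1\ \forall v\in V\cup W\}$. A fractional algorithm $\mathcal A$ is $\rho$-competitive if $\mathcal V(\mathcal A,\mathcal H)\ge \rho\,\mathsf{OPT_{LP}}(\mathcal H)$ for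 every instance $\mathcal H$. *)

(* Defs.v *)
From HB Require Import structures.
From mathcomp Require Import all_boot all_order all_algebra.
From mathcomp Require Import all_classical all_reals all_analysis.

Set Implicit Arguments.
Unset Strict Implicit.
Unset Printing Implicit Defensive.

Import Order.TTheory GRing.Theory Num.Theory.

Local Open Scope ring_scope.

(* The online nodes are W = 'I_m, in order of arrival.  The hyperedge
   {w, u, v} with w online and u <> v offline is the pair (w, [set u; v]). *)
Record hypergraph (V : finType) (m : nat) := Hypergraph {
  hyperedges :> {set 'I_m * {set V}};
  hypergraph_uniform : forall h, h \in hyperedges -> #|h.2| = 2%N
}.

Section OfflineProblem.
Context {R : realType} {V : finType} {m : nat}.
Variable H : hypergraph V m.

Definition incident (v : V + 'I_m) (h : 'I_m * {set V}) : bool :=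
  match v with inl u => u \in h.2 | inr w => w == h.1 end.

Definition delta (v : V + 'I_m) : {set 'I_m * {set V}} :=
  [set h in hyperedges H | incident v h]%SET.

Definition fractional_matching (x : 'I_m * {set V} -> R) : Prop :=
  (forall h, h \in hyperedges H -> 0 <= x h) /\
  (forall v : V + 'I_m, \sum_(h in delta v) x h <= 1).

Definition weight (x : 'I_m * {set V} -> R) : R :=
  \sum_(h in hyperedges H) x h.

(* The feasible region is nonempty and compact, so that this supremum is
   the maximum. *)
Definition OPT_LP : R :=
  sup [set weight x | x in [set x | fractional_matching x]]%classic.

End OfflineProblem.
Arguments OPT_LP R {V m} H.

Section OnlineAlgorithms.
Variable R : realType.

(* An arriving online node w is revealed to the algorithm through the set of
   offline pairs e such that (w, e) is a hyperedge.  A deterministic algorithm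
   knows V; from the list of what has been revealed so far, the current arrival
   being the last item, it computes the value of each hyperedge of the current
   arrival.  Its own past decisions are determined by this list. *)
Definition algorithm : Type :=
  forall V : finType, seq {set {set V}} -> {set V} -> R.

Definition arrival (V : finType) (m : nat) (H : hypergraph V m) (w : 'I_m) :
    {set {set V}} :=
  [set e : {set V} | (w, e) \in hyperedges H]%SET.

Definition history (V : finType) (m : nat) (H : hypergraph V m) (w : 'I_m) :
    seq {set {set V}} :=
  [seq arrival H w' | w' : 'I_m <- enum 'I_m & (w' <= w)%N].

Definition run (A : algorithm) (V : finType) (m : nat) (H : hypergraph V m)
    (h : 'I_m * {set V}) : R :=
  A V (history H h.1) h.2.

(* The state after each arrival is the outcome of a run on a shorter instance,
   so that this is feasibility at all times. *)
Definition feasible (A : algorithm) : Prop :=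
  forall (V : finType) (m : nat) (H : hypergraph V m),
    fractional_matching H (run A H).

Definition value (A : algorithm) (V : finType) (m : nat)
    (H : hypergraph V m) : R :=
  weight H (run A H).

Definition competitive (rho : R) (A : algorithm) : Prop :=
  forall (V : finType) (m : nat) (H : hypergraph V m),
    rho * OPT_LP R H <= value A H.

Section Randomized.
Context {d : measure_display} {T : measurableType d}.

(* A randomized algorithm is a random deterministic one; each of its decisions
   is a random variable. *)
Definition measurable_decisions (A : T -> algorithm) : Prop :=
  forall (V : finType) (m : nat) (H : hypergraph V m) (h : 'I_m * {set V}),
    h \in hyperedges H ->
    measurable_fun [set: T]%classic (fun omega => run (A omega) H h).

Definition competitive_in_expectation (P : probability T R) (rho : R)
    (A : T -> algorithm) : Prop :=
  forall (V : finType) (m : nat) (H : hypergraph V m),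
    ((rho * OPT_LP R H)%:E <= 'E_P[fun omega => value (A omega) H])%E.

End Randomized.
End OnlineAlgorithms.

(* Main.v *)
(* With price f(t) = e^t / (e + 1), so that f(0) + f(1) = 1, and potential
   F(t) = f(t) - f(0), every pair satisfies
   (1 - f(a) - f(b)) + F(a) + F(b) = (e - 1) / (e + 1).

   Algorithm: an arriving node chooses x maximizing its total gain minus the
   increase of the potentials of the offline loads.  First-order optimality
   makes this surplus at least 1 - f(a) - f(b) on each of its pairs, a and b
   being the new loads, so that surpluses and potentials form a dual solution of
   the value of the algorithm, feasible up to the factor (e - 1) / (e + 1).

   Adversary: nominal loads are the multiples i/g of a small step.  In a phase,
   n disjoint pairs with nominal loads (i, j), i + j <= g, are shown again and
   again.  Either the algorithm gains n/g, and a 1/g fraction of the pairs is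
   matched offline, the others moving to (i+1, j+1); or it does not gain that
   much in n arrivals, and all the pairs are matched offline.  Both outcomes
   preserve, up to O(1/g),
   value <= (e - 1) / (e + 1) * (offline matching) + sum of the potentials.
   Nodes of load i >= g/2 are paired with nodes of load g-1-i; the latter become
   the partners needed by nodes of load i-1 in the next round, the missing ones
   being produced from fresh nodes by phases (j, j) with j < g/2.  Thus the set
   of nodes in play stays bounded while the offline matching grows for ever.
   A randomized algorithm is reduced to the deterministic one taking its
   expected decisions. *)

Require Import Defs.
From HB Require Import structures.
From mathcomp Require Import all_boot all_order all_algebra.
From mathcomp Require Import all_classical all_reals all_analysis.
From mathcomp Require Import ring lra zify.
(* Gives the finite-set reading back to the names shared with classical sets. *)
From mathcomp Require Import fintype finset.

Set Implicit Arguments.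
Unset Strict Implicit.
Unset Printing Implicit Defensive.

Import Order.TTheory GRing.Theory Num.Theory.

Local Open Scope ring_scope.

(** * Prices *)

Section Price.
Variable R : realType.
Implicit Types a b t : R.

Definition opt_ratio : R := (expR 1 - 1) / (expR 1 + 1).
Definition price t : R := expR t / (expR 1 + 1).
Definition potential t : R := (expR t - 1) / (expR 1 + 1).

Lemma expR1_gt1 : 1 < expR 1 :> R.
Proof. by rewrite expR_gt1. Qed.

Lemma expR1D1_gt0 : 0 < expR 1 + 1 :> R.
Proof. by have := expR1_gt1; lra. Qed.

Lemma opt_ratio_gt0 : 0 < opt_ratio.
Proof. by rewrite divr_gt0 ?expR1D1_gt0// subr_gt0 expR1_gt1. Qed.

Lemma opt_ratio_lt1 : opt_ratio < 1.
Proof. by rewrite ltr_pdivrMr ?expR1D1_gt0//; lra. Qed.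

Lemma price_gt0 t : 0 < price t.
Proof. by rewrite divr_gt0 ?expR_gt0 ?expR1D1_gt0. Qed.

(** The subtracted constant is [1 / (e + 1)], the price at load 0. A pair counts it twice, which
    makes [1 - opt_ratio]. *)
Lemma potential_price t : potential t = price t - (1 - opt_ratio) / 2.
Proof.
rewrite /potential /price /opt_ratio; have := expR1D1_gt0 => h.
by field; rewrite gt_eqF.
Qed.

Lemma potential0 : potential 0 = 0.
Proof. by rewrite /potential expR0 subrr mul0r. Qed.

Lemma potential1 : potential 1 = opt_ratio.
Proof. by []. Qed.

Lemma price01 : price 0 + price 1 = 1.
Proof.
by rewrite /price expR0 -mulrDl addrC divff// gt_eqF// expR1D1_gt0.
Qed.

Lemma price_le a b : a <= b -> price a <= price b.
Proof. by move=> ab; rewrite ler_pM2r ?invr_gt0 ?expR1D1_gt0// ler_expR. Qed.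

Lemma price_le1 t : t <= 1 -> price t <= 1.
Proof. by move=> /price_le; have := price_gt0 0; have := price01; lra. Qed.

Lemma potential_le a b : a <= b -> potential a <= potential b.
Proof. by move=> /price_le; rewrite !potential_price; lra. Qed.

Lemma potential_ge0 t : 0 <= t -> 0 <= potential t.
Proof. by move=> /potential_le; rewrite potential0. Qed.

(** [price] is the derivative of the convex function [potential], whose graph lies above its tangent
    at [b]. *)
Lemma potential_convex a b : potential b - potential a <= price b * (b - a).
Proof.
rewrite !potential_price opprB addrA subrK.
have := expR_ge1Dx (a - b); rewrite expRD expRN => h.
rewrite /price -mulrBl mulrAC ler_pM2r ?invr_gt0 ?expR1D1_gt0//.
have eb := expR_gt0 b.
move: h; rewrite ler_pdivlMr// => h; nra.
Qed.

(** Convexity used in both directions gives an upper bound with quadratic error, since prices are at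
    most 1 up to load 1. It controls the second-order term when an optimal allocation is
    perturbed. *)
Lemma potential_quadratic a b : a <= 1 -> b <= 1 ->
  potential b - potential a <= price a * (b - a) + (b - a) ^+ 2.
Proof.
move=> a1 b1; have := potential_convex a b; have := potential_convex b a.
rewrite !potential_price => h1 h2.
have pa := price_le1 a1; have pb := price_le1 b1.
have [ab|/ltW ab] := leP a b.
  have : 0 <= (b - a) * ((b - a) * (1 - price b)).
    by rewrite !mulr_ge0// subr_ge0.
  have : 0 <= (b - a) * (price b * (b - a) - (price b - price a)).
    by rewrite mulr_ge0// subr_ge0//; lra.
  rewrite expr2; nra.
have : 0 <= (a - b) * ((a - b) * (1 - price a)).
  by rewrite !mulr_ge0// subr_ge0.
have : 0 <= (a - b) * (price a * (a - b) - (price a - price b)).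
  by rewrite mulr_ge0// subr_ge0//; lra.
rewrite expr2; nra.
Qed.

(** Superadditivity: [(e^a - 1)(e^b - 1) >= 0], so the sum is at most the potential of [a + b]. *)
Lemma potential_add_le a b : 0 <= a -> 0 <= b -> a + b <= 1 ->
  potential a + potential b <= opt_ratio.
Proof.
move=> a0 b0 ab; rewrite -potential1 -mulrDl ler_pM2r ?invr_gt0 ?expR1D1_gt0//.
have : expR (a + b) <= expR 1 by rewrite ler_expR.
rewrite expRD.
have : 1 <= expR a by rewrite -expR0 ler_expR.
have : 1 <= expR b by rewrite -expR0 ler_expR.
by nra.
Qed.

End Price.

(** * Arrival sequences *)

Section Arrivals.
Variables (R : realType) (V : finType).
Implicit Types (s : seq {set {set V}}) (y : nat -> {set V} -> R).
Implicit Types (P : pred {set V}) (S : {set {set V}}).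

Definition edge_sum P y s : R :=
  \sum_(t < size s) \sum_(e in nth set0 s t | P e) y t e.

Definition decision (A : algorithm R) s : nat -> {set V} -> R :=
  fun t => A V (take t.+1 s).

Definition gained (A : algorithm R) s := edge_sum xpredT (decision A s) s.
Definition load (A : algorithm R) s (v : V) :=
  edge_sum (fun e => v \in e) (decision A s) s.

Definition two_uniform s := forall S e, S \in s -> e \in S -> #|e| = 2.

Lemma edge_sum_cat P y s1 s2 : edge_sum P y (s1 ++ s2) =
  edge_sum P y s1 + edge_sum P (fun t => y (size s1 + t)%N) s2.
Proof.
rewrite /edge_sum size_cat big_split_ord/=; congr (_ + _).
  by apply: eq_bigr => t _; rewrite nth_cat ltn_ord.
by apply: eq_bigr => t _; rewrite nth_cat ltnNge leq_addr/= addKn.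
Qed.

Lemma eq_edge_sum P y y' s : (forall t, (t < size s)%N -> y t =1 y' t) ->
  edge_sum P y s = edge_sum P y' s.
Proof.
by move=> yy'; apply: eq_bigr => t _; apply: eq_bigr => e _; rewrite yy'.
Qed.

(** A decision depends only on the list revealed so far, so a new arrival leaves the earlier terms
    unchanged. *)
Lemma edge_sum_decision_rcons P A s S :
  edge_sum P (decision A (rcons s S)) (rcons s S) =
  edge_sum P (decision A s) s + \sum_(e in S | P e) A V (rcons s S) e.
Proof.
rewrite -{2}cats1 edge_sum_cat; congr (_ + _).
  apply: eq_edge_sum => t ts e.
  rewrite /decision -cats1 take_cat; case: ltnP => // st.
  have -> : t.+1 = size s by apply/eqP; rewrite eqn_leq ts.
  by rewrite subnn take0 cats0 take_size.
rewrite /edge_sum/= big_ord1/=.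
by apply: eq_bigr => e _; rewrite /decision/= addn0 -(size_rcons s S) take_size.
Qed.

Lemma two_uniform_rcons s S : two_uniform s ->
  (forall e, e \in S -> #|e| = 2) -> two_uniform (rcons s S).
Proof.
by move=> us uS S' e; rewrite mem_rcons inE => /orP[/eqP->|];
  [exact: uS|exact: us].
Qed.

End Arrivals.

(** * Instances seen as lists of arrivals *)

Section HypergraphArrivals.
Variables (R : realType) (V : finType) (m : nat) (H : hypergraph V m).

Definition arrivals : seq {set {set V}} := [seq arrival H w | w <- enum 'I_m].

Lemma size_arrivals : size arrivals = m.
Proof. by rewrite size_map size_enum_ord. Qed.

Lemma nth_arrivals (w : 'I_m) : nth set0 arrivals w = arrival H w.
Proof. by rewrite (nth_map w) ?size_enum_ord// nth_ord_enum. Qed.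

Lemma history_take (w : 'I_m) : history H w = take w.+1 arrivals.
Proof.
rewrite /history /arrivals -map_take; congr map.
apply: (inj_map val_inj); rewrite map_take.
rewrite -(@filter_map _ _ val (fun i => i <= w)%N) val_enum_ord.
apply: (sorted_eq leq_trans anti_leq).
- by rewrite sorted_filter ?iota_sorted//; exact: leq_trans.
- by rewrite take_sorted ?iota_sorted.
apply: uniq_perm; rewrite ?filter_uniq ?take_uniq ?iota_uniq// => i.
rewrite take_iota mem_filter !mem_iota !add0n /=.
by rewrite (minn_idPl (ltn_ord w)) ltnS; case: (leqP i w) => //= iw;
  rewrite (leq_ltn_trans iw).
Qed.

Lemma runE (A : algorithm R) h : run A H h = decision A arrivals h.1 h.2.
Proof. by rewrite /run history_take. Qed.

Lemma sum_hyperedges (P : pred {set V}) (x : 'I_m * {set V} -> R) :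
  \sum_(h in hyperedges H | P h.2) x h =
  \sum_(w < m) \sum_(e in arrival H w | P e) x (w, e).
Proof.
rewrite pair_big_dep/=; apply: eq_big => [[w e]|[w e] _]//=.
by rewrite inE.
Qed.

Lemma sum_arrivals (x : 'I_m * {set V} -> R) :
  \sum_(h in hyperedges H) x h = \sum_(w < m) \sum_(e in arrival H w) x (w, e).
Proof.
rewrite pair_big_dep/=; apply: eq_big => [[w e]|[w e] _]//=.
by rewrite inE.
Qed.

Lemma sum_hyperedges_arrivals (P : pred {set V}) (y : nat -> {set V} -> R) :
  \sum_(h in hyperedges H | P h.2) y h.1 h.2 = edge_sum P y arrivals.
Proof.
rewrite sum_hyperedges /edge_sum size_arrivals.
by apply: eq_bigr => w _; rewrite nth_arrivals.
Qed.

Lemma sum_delta_online (x : 'I_m * {set V} -> R) w :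
  \sum_(h in delta H (inr w)) x h = \sum_(e in arrival H w) x (w, e).
Proof.
transitivity (\sum_(w' | w' == w) \sum_(e in arrival H w') x (w', e)).
  rewrite pair_big_dep/=; apply: eq_big => [[w' e]|[w' e] _]//=.
  by rewrite !inE/= andbC eq_sym.
by rewrite big_pred1_eq.
Qed.

Lemma sum_delta_offline (x : 'I_m * {set V} -> R) v :
  \sum_(h in delta H (inl v)) x h =
  \sum_(h in hyperedges H | v \in h.2) x h.
Proof. by apply: eq_bigl => h; rewrite inE. Qed.

Lemma weight_run (A : algorithm R) : value A H = gained A arrivals.
Proof.
rewrite /value /weight /gained -sum_hyperedges_arrivals.
by apply: eq_big => [h|h _]; rewrite ?andbT ?runE.
Qed.

Lemma load_run (A : algorithm R) v :
  \sum_(h in delta H (inl v)) run A H h = load A arrivals v.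
Proof.
rewrite sum_delta_offline /load -sum_hyperedges_arrivals.
by apply: eq_bigr => h _; rewrite runE.
Qed.

Lemma weight_le_card (x : 'I_m * {set V} -> R) :
  fractional_matching H x -> weight H x <= m%:R.
Proof.
move=> [_ x1]; rewrite /weight sum_arrivals.
rewrite -[X in X%:R]card_ord -sumr_const; apply: ler_sum => w _.
by have := x1 (inr w); rewrite sum_delta_online.
Qed.

Lemma weight_le_OPT (x : 'I_m * {set V} -> R) :
  fractional_matching H x -> weight H x <= OPT_LP R H.
Proof.
move=> xH; apply: ub_le_sup; last by exists x.
by exists m%:R => _ [z zH <-]; exact: weight_le_card.
Qed.

Lemma OPT_le c : (forall x : 'I_m * {set V} -> R,
  fractional_matching H x -> weight H x <= c) -> OPT_LP R H <= c.
Proof.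
move=> cP; apply: ge_sup; last by move=> _ [x xH <-]; exact: cP.
exists 0; exists (fun=> 0); last by rewrite /weight big1.
by split=> // v; rewrite big1.
Qed.

End HypergraphArrivals.

(** * Lists of arrivals turned back into instances *)

Section ListHypergraph.
Variables (R : realType) (V : finType) (s : seq {set {set V}}).
Hypothesis us : two_uniform s.

Let edges : {set 'I_(size s) * {set V}} :=
  [set h : 'I_(size s) * {set V} | h.2 \in nth set0 s h.1].

Fact edges_uniform (h : 'I_(size s) * {set V}) :
  h \in edges -> #|h.2| = 2.
Proof. by rewrite inE; apply: us; exact: mem_nth. Qed.

Definition list_hypergraph := Hypergraph edges_uniform.

Lemma arrivals_list_hypergraph : arrivals list_hypergraph = s.
Proof.
apply: (@eq_from_nth _ set0); rewrite size_arrivals// => i is_.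
rewrite (nth_arrivals list_hypergraph (Ordinal is_)).
by apply/setP => e; rewrite !inE.
Qed.

Lemma feasible_decision (A : algorithm R) (t : nat) e : feasible A ->
  (t < size s)%N -> e \in nth set0 s t -> 0 <= decision A s t e.
Proof.
move=> /(_ _ _ list_hypergraph)[A0 _] ts es.
have := A0 (Ordinal ts, e); rewrite runE arrivals_list_hypergraph; apply.
by rewrite inE.
Qed.

Lemma feasible_arrival (A : algorithm R) (t : nat) : feasible A ->
  (t < size s)%N -> \sum_(e in nth set0 s t) decision A s t e <= 1.
Proof.
move=> /(_ _ _ list_hypergraph)[_ A1] ts; have := A1 (inr (Ordinal ts)).
rewrite sum_delta_online -(nth_arrivals list_hypergraph).
under eq_bigr do rewrite runE.
by rewrite arrivals_list_hypergraph.
Qed.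

Lemma feasible_load (A : algorithm R) v : feasible A -> load A s v <= 1.
Proof.
move=> /(_ _ _ list_hypergraph)[_ A1]; have := A1 (inl v).
by rewrite load_run arrivals_list_hypergraph.
Qed.

End ListHypergraph.

(** * The water-filling algorithm *)

Section Continuity.
Import numFieldNormedType.Exports.

Lemma continuous_finite_sum (R : realType) (T : topologicalType) (I : finType)
    (Q : pred I) (f : I -> T -> R) : (forall i, continuous (f i)) ->
  continuous (fun x => \sum_(i | Q i) f i x).
Proof.
move=> fc; elim: (index_enum I) => [|i r IH].
  by under eq_fun do rewrite big_nil; exact: cst_continuous.
under eq_fun do rewrite big_cons.
by case: (Q i) => // x; apply: cvgD; [exact: fc|exact: IH].
Qed.

Lemma continuous_potential_comp (R : realType) (T : topologicalType)
    (f : T -> R) : continuous f -> continuous (fun x => potential (f x)).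
Proof.
move=> fc x; apply: cvgMl; apply: cvgB; last exact: cvg_cst.
exact: (continuous_comp (fc x) (@continuous_expR R (f x))).
Qed.

Lemma continuous_sub (R : realType) (T : topologicalType) (f h : T -> R) :
  continuous f -> continuous h -> continuous (fun x => f x - h x).
Proof. by move=> fc hc x; apply: cvgB; [exact: fc|exact: hc]. Qed.

End Continuity.

(** * The allocation of a single arrival: existence and first-order optimality *)

Section Allocation.
Variables (R : realType) (V : finType).
Implicit Types (l : V -> R) (S : {set {set V}}) (x : {set V} -> R) (e : {set
  V}).

Definition new_load l S x v := l v + \sum_(e in S | v \in e) x e.

(** The bounds are imposed on all pairs, also outside [S], so that this set is compact in the space
    of all functions on pairs. *)
Definition allocations l S : set ({set V} -> R) :=
  [set x | [/\ forall e, 0 <= x e <= 1, \sum_(e in S) x e <= 1 &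
    forall v, new_load l S x v <= 1]]%classic.

(* The value of the dual variable of the arriving node: what is left of the
   gain once the offline nodes have been paid the increase of their potential.
     *)
Definition surplus l S x : R := \sum_(e in S) x e -
  \sum_v (potential (new_load l S x v) - potential (l v)).

(** A maximizer exists whenever the loads are at most 1 ([allocateP]); the default [fun=> 0] makes
    the definition total. *)
Definition allocate l S : {set V} -> R :=
  xget (fun=> 0) [set x | allocations l S x /\
    forall y, allocations l S y -> surplus l S y <= surplus l S x]%classic.

Section Compactness.
Import numFieldNormedType.Exports.
Local Open Scope classical_set_scope.

Let coordinates (c : 'rV[R]_#|{set V}|) : {set V} -> R :=
  fun e => c ord0 (enum_rank e).

Let continuous_coordinates (Q : pred {set V}) :
  continuous (fun c => \sum_(e | Q e) coordinates c e).
Proof. by apply: continuous_finite_sum => e; exact: coord_continuous. Qed.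

Let continuous_new_load l S v :
  continuous (fun c => new_load l S (coordinates c) v).
Proof.
under eq_fun do rewrite /new_load -[l v]opprK addrC.
apply: continuous_sub; first exact: continuous_coordinates.
exact: cst_continuous.
Qed.

Let continuous_surplus l S : continuous (fun c => surplus l S (coordinates c)).
Proof.
apply: continuous_sub; first exact: continuous_coordinates.
apply: continuous_finite_sum => v; apply: continuous_sub.
  exact: (continuous_potential_comp (@continuous_new_load l S v)).
exact: cst_continuous.
Qed.

Let compact_allocations l S : compact [set c | allocations l S (coordinates c)].
Proof.
have -> : [set c | allocations l S (coordinates c)] =
    [set c : 'rV[R]_#|{set V}| | forall i, `[0, 1]%classic (c ord0 i)] `&`
    ([set c | \sum_(e in S) coordinates c e <= 1] `&`
     \bigcap_(v in [set: V]%classic) [set c | new_load l S (coordinates c) v <=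
       1]).
  apply/seteqP; split=> [c [c01 c1 cl]|c [c01 [c1 cl]]].
    split=> [i|]; last by split=> // v _; exact: cl.
    by have := c01 (enum_val i); rewrite /coordinates enum_valK /= in_itv.
  split=> // [e|v]; last exact: (cl v).
  by have := c01 (enum_rank e); rewrite /= in_itv.
apply: compact_closedI; first exact: (rV_compact (fun=> @segment_compact R 0
  1)).
apply: closedI.
  apply: (preimage_closed _ (@closed_le _ _)) => c _.
  exact: continuous_coordinates.
apply: closed_bigI => v _; apply: (preimage_closed _ (@closed_le _ _)) => c _.
exact: continuous_new_load.
Qed.

Lemma allocations0 l S : (forall v, l v <= 1) -> allocations l S (fun=> 0).
Proof.
move=> l1; split=> [e||v]; first by rewrite lexx ler01.
  by rewrite big1.
by rewrite /new_load big1// addr0.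
Qed.

(** Extreme value theorem, after identifying functions on pairs with row vectors: the surplus is
    continuous, and the allocations form a compact set containing 0. *)
Lemma allocateP l S : (forall v, l v <= 1) -> allocations l S (allocate l S) /\
  forall y, allocations l S y -> surplus l S y <= surplus l S (allocate l S).
Proof.
move=> l1; have [||c cA cmax] := @EVT_max_rV R _
    (fun c => surplus l S (coordinates c)) _ _ (@compact_allocations l S).
- exists (\row_i 0); rewrite /= (_ : coordinates _ = fun=> 0).
    exact: allocations0.
  by apply/funext => e; rewrite /coordinates mxE.
- exact/continuous_subspaceT/(@continuous_surplus l S).
apply: (@xgetPex _ (fun=> 0) [set x | allocations l S x /\
  forall y, allocations l S y -> surplus l S y <= surplus l S x]).
exists (coordinates c); split=> [|y yA]; first exact: set_mem cA.
have yE : y = coordinates (\row_i y (enum_val i)).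
  by apply/funext => e; rewrite /coordinates mxE enum_rankK.
by rewrite yE; apply: cmax; apply: mem_set; rewrite /= -yE.
Qed.

End Compactness.

Section Optimality.
Variables (l : V -> R) (S : {set {set V}}).
Hypothesis l01 : forall v, 0 <= l v <= 1.
Local Notation x := (allocate l S).
Local Notation l' := (new_load l S x).

Let l1 v : l v <= 1. Proof. by case/andP: (l01 v). Qed.

Lemma allocate_ge0 e : 0 <= x e.
Proof. by have [[x01 _ _] _] := allocateP S l1; case/andP: (x01 e). Qed.

Lemma allocate_sum_le1 : \sum_(e in S) x e <= 1.
Proof. by have [[]] := allocateP S l1. Qed.

Lemma new_load_le1 v : l' v <= 1.
Proof. by have [[]] := allocateP S l1. Qed.

Lemma new_load_ge v : l v <= l' v.
Proof. by rewrite lerDl sumr_ge0// => e _; exact: allocate_ge0. Qed.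

Lemma new_load_ge0 v : 0 <= l' v.
Proof. by rewrite (le_trans _ (new_load_ge v))//; case/andP: (l01 v). Qed.

(** The zero allocation is allowed and has surplus 0. *)
Lemma surplus_ge0 : 0 <= surplus l S x.
Proof.
have [_ xmax] := allocateP S l1; apply: le_trans (xmax _ (allocations0 S l1)).
rewrite /surplus big1// sub0r oppr_ge0 big1// => v _.
by rewrite /new_load big1// addr0 subrr.
Qed.

(** Moves from the maximizer towards the allocation giving everything to [e]. A convex combination
    keeps the total at most 1, so only the nodes of [e] can run out of capacity. *)
Let shift e t : {set V} -> R := fun e' => (1 - t) * x e' + t * (e' == e)%:R.

Let sum_shift (Q : pred {set V}) e t : e \in S ->
  \sum_(e' in S | Q e') shift e t e' =
  (1 - t) * (\sum_(e' in S | Q e') x e') + t * (Q e)%:R.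
Proof.
move=> eS; rewrite big_split/= -!mulr_sumr; congr (_ + t * _).
have [Qe|Qe] := boolP (Q e); last first.
  rewrite big1// => e' /andP[_ Qe']; case: eqP => // E.
  by rewrite E (negbTE Qe) in Qe'.
rewrite (bigD1 e) ?eS//= eqxx big1 ?addr0// => e' /andP[_ /negbTE->].
by [].
Qed.

Let new_load_shift e t v : e \in S -> new_load l S (shift e t) v =
  l' v + t * ((v \in e)%:R - (l' v - l v)).
Proof. by move=> eS; rewrite /new_load sum_shift//; ring. Qed.

(** The factor of [t] on the left is the directional derivative of the surplus towards [e]. The
    maximizer cannot be improved, so the linear gain is at most the quadratic errors, one [t ^+ 2]
    per node. *)
Let surplus_shift e t : e \in S -> 0 <= t <= 1 ->
  (forall v, v \in e -> l' v + t <= 1) ->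
  t * (1 - \sum_(e in S) x e -
    \sum_v price (l' v) * ((v \in e)%:R - (l' v - l v))) <= t ^+ 2 * #|V|%:R.
Proof.
move=> eS /andP[t0 t1] le1.
have d01 v : 0 <= l' v - l v <= 1.
  rewrite subr_ge0 new_load_ge/=; have := new_load_le1 v.
  by case/andP: (l01 v); lra.
have shift_le1 v : new_load l S (shift e t) v <= 1.
  rewrite new_load_shift//; have [ve|ve] := boolP (v \in e).
    have := le1 v ve; case/andP: (d01 v) => d0 _.
    by have := mulr_ge0 t0 d0; rewrite /=; lra.
  have := new_load_le1 v; case/andP: (d01 v) => d0 _.
  by have := mulr_ge0 t0 d0; rewrite /=; lra.
have sum1 := sum_shift xpredT t eS.
rewrite !(eq_bigl (mem S)) in sum1; try by move=> ?; rewrite andbT.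
have shiftA : allocations l S (shift e t).
  split=> [e'||//].
    have [[x01 _ _] _] := allocateP S l1; case/andP: (x01 e') => x0 x1.
    have h0 : 0 <= (1 - t) * x e' by rewrite mulr_ge0// subr_ge0.
    have h1 : (1 - t) * x e' <= (1 - t) * 1 by rewrite ler_wpM2l// subr_ge0.
    by rewrite /shift; case: eqP => _ /=; lra.
  have : (1 - t) * \sum_(e in S) x e <= (1 - t) * 1.
    by rewrite ler_wpM2l ?subr_ge0 ?allocate_sum_le1.
  by rewrite sum1 /=; lra.
have [_ /(_ _ shiftA)] := allocateP S l1.
rewrite /surplus sum1 => opt.
have bound v : potential (new_load l S (shift e t) v) - potential (l v) <=
    (potential (l' v) - potential (l v)) +
    t * (price (l' v) * ((v \in e)%:R - (l' v - l v))) + t ^+ 2.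
  have := potential_quadratic (new_load_le1 v) (shift_le1 v).
  have -> : new_load l S (shift e t) v - l' v = t * ((v \in e)%:R - (l' v - l
    v)).
    by rewrite new_load_shift// addrC addKr.
  rewrite exprMn.
  have : ((v \in e)%:R - (l' v - l v)) ^+ 2 <= 1.
    by case: (v \in e) => /=; case/andP: (d01 v) => *; nra.
  move=> /(ler_wpM2l (sqr_ge0 t)); lra.
have sum_bound : \sum_v (potential (new_load l S (shift e t) v) - potential (l
  v)) <=
    \sum_v (potential (l' v) - potential (l v)) +
    t * (\sum_v price (l' v) * ((v \in e)%:R - (l' v - l v))) + t ^+ 2 *
      #|V|%:R.
  apply: le_trans (ler_sum _ (fun v _ => bound v)) _.
  rewrite [leLHS]big_split/= [X in X + _ <= _]big_split/= -mulr_sumr.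
  by rewrite sumr_const mulr_natr.
by move: opt sum_bound; rewrite /=; lra.
Qed.

(** If a node of [e] is saturated, the two prices sum to at least [price 1 + price 0 = 1] and a
    nonnegative surplus suffices. Otherwise the derivative towards [e] is at most 0, and convexity
    bounds the increase of each potential by the final price times the increase of the load. *)
Lemma price_le_surplus e : e \in S -> #|e| = 2 ->
  1 - \sum_(v in e) price (l' v) <= surplus l S x.
Proof.
move=> eS /eqP/cards2P[u [w [uw eE]]].
have sumE (f : V -> R) : \sum_(v in e) f v = f u + f w.
  by rewrite eE big_setU1 ?big_set1// inE.
have saturated a b : 1 <= l' a -> 1 - (price (l' a) + price (l' b)) <=
  surplus l S x.
  move=> /price_le; have := price_le (new_load_ge0 b).
  by have := price01 R; have := surplus_ge0; lra.
rewrite sumE; have [u1|u1] := leP 1 (l' u); first exact: (saturated u w u1).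
have [w1|w1] := leP 1 (l' w); first by rewrite [X in _ - X]addrC;
  exact: (saturated w u w1).
pose slope := 1 - \sum_(e in S) x e -
  \sum_v price (l' v) * ((v \in e)%:R - (l' v - l v)).
have slope_le0 : slope <= 0.
  rewrite leNgt; apply/negP => slope0.
  have n0 : 0 < #|V|%:R + 1 :> R by rewrite ltr_wpDl.
  (* The first two bounds keep the shifted allocation feasible; the third makes the linear gain
     exceed the quadratic error. *)
  pose t := Num.min (Num.min (1 - l' u) (1 - l' w)) (slope / (#|V|%:R + 1)).
  have t0 : 0 < t by rewrite !lt_min !subr_gt0 u1 w1 divr_gt0.
  have [tu tw ts] : [/\ t <= 1 - l' u, t <= 1 - l' w & t <=
    slope / (#|V|%:R + 1)].
    by rewrite /t !ge_min !lexx !orbT.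
  have t1 : t <= 1 by have := new_load_ge0 u; lra.
  have := @surplus_shift e t eS; rewrite (ltW t0) t1 => /(_ isT).
  have h v : v \in e -> l' v + t <= 1.
    by rewrite eE !inE => /orP[]/eqP->; lra.
  move=> /(_ h); rewrite -/slope expr2 -mulrA ler_pM2l//.
  move: ts; rewrite ler_pdivlMr// => ts; nra.
have priceE : \sum_v price (l' v) * ((v \in e)%:R - (l' v - l v)) =
    \sum_(v in e) price (l' v) - \sum_v price (l' v) * (l' v - l v).
  rewrite [\sum_(v in e) _]big_mkcond/= -sumrB; apply: eq_bigr => v _.
  by case: (v \in e) => /=; ring.
have : \sum_v (potential (l' v) - potential (l v)) <=
    \sum_v price (l' v) * (l' v - l v).
  by apply: ler_sum => v _; exact: potential_convex.
move: slope_le0; rewrite /slope priceE sumE /surplus; lra.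
Qed.

End Optimality.
End Allocation.

(** * Primal-dual analysis of the algorithm *)

Section WaterFilling.
Variable R : realType.

Definition final_load (V : finType) (s : seq {set {set V}}) : V -> R :=
  foldl (fun l S => new_load l S (allocate l S)) (fun=> 0) s.

(** No state is kept: the loads before the current arrival, which is the last item, are recomputed
    from the earlier items. *)
Definition water_filling : algorithm R := fun V s e =>
  allocate (final_load (take (size s).-1 s)) (last set0 s) e.

Section Run.
Variable V : finType.
Implicit Types s : seq {set {set V}}.

Lemma final_load_rcons s S : final_load (rcons s S) =
  new_load (final_load s) S (allocate (final_load s) S).
Proof. exact: foldl_rcons. Qed.

Lemma water_filling_rcons s S :
  @water_filling V (rcons s S) = allocate (final_load s) S.
Proof.
apply/funext => e; rewrite /water_filling size_rcons last_rcons/=.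
by rewrite -cats1 take_size_cat.
Qed.

Lemma decision_water_filling s t : (t < size s)%N ->
  decision water_filling s t = allocate (final_load (take t s)) (nth set0 s t).
Proof.
by move=> ts; rewrite /decision (take_nth set0 ts) water_filling_rcons.
Qed.

Lemma final_load01 s v : 0 <= final_load s v <= 1.
Proof.
elim/last_ind: s v => [|s S IH] v; first by rewrite lexx ler01.
by rewrite final_load_rcons new_load_ge0// new_load_le1.
Qed.

Lemma load_water_filling s v : load water_filling s v = final_load s v.
Proof.
elim/last_ind: s => [|s S IH]; first by rewrite /load /edge_sum big_ord0.
rewrite /load edge_sum_decision_rcons final_load_rcons /new_load -IH.
by rewrite water_filling_rcons.
Qed.

Lemma final_load_take_le s (k : nat) v : (k <= size s)%N ->
  final_load (take k s) v <= final_load s v.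
Proof.
elim/last_ind: s => [|s S IH] in k *; first by case: k.
rewrite size_rcons leq_eqVlt => /orP[/eqP->|];
  first by rewrite -(size_rcons s S) take_size.
rewrite ltnS => ks; rewrite -cats1 takel_cat// cats1 final_load_rcons.
by rewrite (le_trans (IH _ ks))// new_load_ge// => w; exact: final_load01.
Qed.

Definition online_dual s t :=
  surplus (final_load (take t s)) (nth set0 s t)
    (allocate (final_load (take t s)) (nth set0 s t)).

Lemma online_dual_ge0 s t : 0 <= online_dual s t.
Proof. exact: surplus_ge0 (final_load01 _). Qed.

(** Each arrival gains its surplus plus the increase of the potentials; these increases telescope
    from load 0. *)
Lemma gained_water_filling s : gained water_filling s =
  \sum_(t < size s) online_dual s t + \sum_v potential (final_load s v).
Proof.
elim/last_ind: s => [|s S IH].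
  rewrite /gained /edge_sum !big_ord0 add0r big1// => v _.
  exact: potential0.
rewrite /gained edge_sum_decision_rcons -/(gained water_filling s) {}IH.
rewrite water_filling_rcons size_rcons big_ord_recr/=.
have -> : \sum_(t < size s) online_dual (rcons s S) t =
    \sum_(t < size s) online_dual s t.
  apply: eq_bigr => t _; rewrite /online_dual nth_rcons ltn_ord -cats1.
  by rewrite takel_cat// ltnW.
have take_s : take (size s) (rcons s S) = s by rewrite -cats1 take_size_cat.
set duals := \sum_(t < size s) _; rewrite /online_dual nth_rcons ltnn eqxx
  take_s.
rewrite final_load_rcons /surplus sumrB.
under [X in _ + X = _]eq_bigl do rewrite andbT.
by ring.
Qed.

(** Dual feasibility up to the factor [opt_ratio]. It holds right after the arrival by
    [price_le_surplus], and persists because loads, hence potentials, only grow. *)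
Lemma ratio_le_dual s t e : (t < size s)%N -> e \in nth set0 s t -> #|e| = 2 ->
  opt_ratio R <= online_dual s t + \sum_(v in e) potential (final_load s v).
Proof.
move=> ts es e2; have := price_le_surplus (final_load01 (take t s)) es e2.
rewrite -/(online_dual s t) => h.
have : \sum_(v in e) potential (final_load (take t.+1 s) v) <=
    \sum_(v in e) potential (final_load s v).
  by apply: ler_sum => v _; apply: potential_le; exact: final_load_take_le.
rewrite (take_nth set0 ts) final_load_rcons.
under eq_bigr do rewrite potential_price.
by rewrite sumrB sumr_const e2 mulr2n; lra.
Qed.

End Run.

Lemma water_filling_feasible : feasible water_filling.
Proof.
move=> V m H; have size_w (w : 'I_m) : (w < size (arrivals H))%N by rewrite
  size_arrivals.
have l01 (w : 'I_m) := @final_load01 V (take w (arrivals H)).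
split=> [h hH|[v|w]].
- by rewrite runE decision_water_filling// allocate_ge0.
- by rewrite load_run load_water_filling;
    case/andP: (final_load01 (arrivals H) v).
- rewrite sum_delta_online -(nth_arrivals H).
  under eq_bigr do rewrite runE decision_water_filling//=.
  exact: allocate_sum_le1.
Qed.

(** Weak duality: weight the dual inequality of each hyperedge by [z] and exchange sums; every dual
    variable is then multiplied by at most 1. *)
Lemma water_filling_competitive : competitive (opt_ratio R) water_filling.
Proof.
move=> V m H; rewrite -ler_pdivlMl ?opt_ratio_gt0//; apply: OPT_le => z zH.
rewrite ler_pdivlMl ?opt_ratio_gt0// weight_run gained_water_filling.
have [z0 z1] := zH; rewrite size_arrivals.
set s := arrivals H; set y := online_dual s;
  set p := fun v => potential (final_load s v).
have p0 v : 0 <= p v by apply: potential_ge0; case/andP: (final_load01 s v).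
apply: (@le_trans _ _ (\sum_(h in hyperedges H) z h * (y h.1 + \sum_(v in h.2)
  p v))).
  rewrite /weight mulr_sumr; apply: ler_sum => -[w e] hH;
    rewrite mulrC ler_wpM2l ?z0//.
  apply: ratio_le_dual; rewrite ?size_arrivals//=.
    by rewrite nth_arrivals inE.
  exact: (hypergraph_uniform hH).
under eq_bigr do rewrite mulrDr; rewrite big_split/=; apply: lerD.
  rewrite sum_arrivals; apply: ler_sum => w _.
  rewrite /= -mulr_suml ler_piMl ?online_dual_ge0//.
  by have := z1 (inr w); rewrite sum_delta_online.
under eq_bigr do rewrite mulr_sumr big_mkcond/=.
rewrite exchange_big/=; apply: ler_sum => v _.
rewrite -big_mkcondr/= -mulr_suml ler_piMl//.
by have := z1 (inl v); rewrite sum_delta_offline.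
Qed.

End WaterFilling.

(** * Packings and repeated arrivals *)

Section Packing.
Variables (R : realType) (V : finType).
Implicit Types (s : seq {set {set V}}) (D : {set V}) (q : nat).

Definition packing s D q := exists z : nat -> {set V} -> R,
  [/\ forall t e, 0 <= z t e,
      forall t, (t < size s)%N -> \sum_(e in nth set0 s t) z t e <= 1,
      forall v, edge_sum (fun e => v \in e) z s <= (v \in D)%:R &
      edge_sum xpredT z s = q%:R].

Lemma packing_nil : packing [::] set0 0.
Proof.
exists (fun _ _ => 0); split=> // [v|]; rewrite /edge_sum big_ord0//.
Qed.

Lemma packing_le_OPT s D q (us : two_uniform s) :
  packing s D q -> q%:R <= OPT_LP R (list_hypergraph us).
Proof.
move=> [z [z0 z1 zD zq]].
pose x (h : 'I_(size s) * {set V}) := z h.1 h.2.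
have -> : q%:R = weight (list_hypergraph us) x.
  rewrite -zq /weight -[in LHS](arrivals_list_hypergraph us).
  by rewrite -sum_hyperedges_arrivals; apply: eq_bigl => h; rewrite andbT.
apply: weight_le_OPT; split=> [h _|[v|w]]; first exact: z0.
  rewrite sum_delta_offline (sum_hyperedges_arrivals (list_hypergraph us) (fun
    e => v \in e)).
  by rewrite arrivals_list_hypergraph (le_trans (zD v))// lern1 leq_b1.
rewrite sum_delta_online -(nth_arrivals (list_hypergraph us)).
by rewrite arrivals_list_hypergraph z1.
Qed.

Lemma edge_sum_nseq (P : pred {set V}) (z : {set V} -> R) t S :
  edge_sum P (fun=> z) (nseq t S) = t%:R * \sum_(e in S | P e) z e.
Proof.
rewrite /edge_sum size_nseq (eq_bigr (fun=> \sum_(e in S | P e) z e)).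
  by rewrite sumr_const card_ord mulr_natl.
by move=> i _; rewrite nth_nseq ltn_ord.
Qed.

End Packing.

Section Pairs.
Variables (R : realType) (V : finType) (n : nat) (u w : 'I_n -> V).
Hypotheses (u_inj : injective u) (w_inj : injective w).
Hypothesis uw : forall i j, u i != w j.

Definition pair i : {set V} := [set u i; w i].
Definition pairs : {set {set V}} := [set pair i | i : 'I_n].

Lemma in_pair_l i j : (u i \in pair j) = (i == j).
Proof. by rewrite !inE (inj_eq u_inj) (negbTE (uw _ _)) orbF. Qed.

Lemma in_pair_r i j : (w i \in pair j) = (i == j).
Proof. by rewrite !inE (inj_eq w_inj) eq_sym (negbTE (uw _ _)). Qed.

Lemma pair_inj : injective pair.
Proof.
by move=> i j ij; apply/eqP; rewrite -in_pair_l -ij in_pair_l.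
Qed.

Lemma card_pairs e : e \in pairs -> #|e| = 2.
Proof. by move=> /imsetP[i _ ->]; rewrite cards2 uw. Qed.

Lemma sum_pairs (P : pred {set V}) (f : {set V} -> R) :
  \sum_(e in pairs | P e) f e = \sum_(i | P (pair i)) f (pair i).
Proof.
rewrite big_mkcondr big_imset/=; last by move=> i j _ _; exact: pair_inj.
by rewrite -big_mkcond.
Qed.

(** Each pair of [Q] receives [1 / t] in each of the [t] repetitions: 1 per pair in total, and
    [#|Q| / t <= 1] per online node. *)
Lemma packing_pairs s (D : {set V}) q (Q : {set 'I_n}) t :
  (forall i, u i \notin D) -> (forall i, w i \notin D) ->
  (#|Q| <= t)%N -> packing R s D q ->
  packing R (s ++ nseq t pairs) (D :|: u @: Q :|: w @: Q) (q + #|Q|).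
Proof.
move=> uD wD Qt [z [z0 z1 zD zq]].
have [t0|t0] := posnP t.
  move: Qt; rewrite t0 leqn0 => /eqP/cards0_eq ->.
  by rewrite !imset0 !setU0 cards0 addn0 cats0; exists z.
have tR : t%:R != 0 :> R by rewrite pnatr_eq0 -lt0n.
pose zeta e : R := if e \in pair @: Q then t%:R^-1 else 0.
have zeta0 e : 0 <= zeta e by rewrite /zeta; case: ifP; rewrite ?invr_ge0.
have zetaE i : zeta (pair i) = if i \in Q then t%:R^-1 else 0.
  by rewrite /zeta mem_imset//; exact: pair_inj.
pose z' t' e := if (t' < size s)%N then z t' e else zeta e.
have z'E P : edge_sum P z' (s ++ nseq t pairs) =
    edge_sum P z s + t%:R * \sum_(i in Q | P (pair i)) t%:R^-1.
  rewrite edge_sum_cat; congr (_ + _).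
    by apply: eq_edge_sum => t' ts e; rewrite /z' ts.
  rewrite (@eq_edge_sum _ _ _ _ (fun=> zeta)).
    rewrite edge_sum_nseq sum_pairs; congr (_ * _).
    under eq_bigr do rewrite zetaE.
    by rewrite -big_mkcondr; apply: eq_bigl => i; rewrite andbC.
  by move=> t' _ e; rewrite /z' ltnNge leq_addr.
exists z'; split.
- by move=> t' e; rewrite /z'; case: ifP.
- move=> t'; rewrite size_cat size_nseq nth_cat nth_nseq /z'.
  case: (ltnP t' (size s)) => [ts _|st tt]; first exact: z1.
  rewrite ltn_subLR// tt (eq_bigl (fun e => (e \in pairs) && true)); last first.
    by move=> e; rewrite andbT.
  rewrite sum_pairs/=; under eq_bigr do rewrite zetaE.
  rewrite -big_mkcond/= sumr_const -[leLHS]mulr_natr mulrC ler_pdivrMr ?ltr0n//.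
  by rewrite mul1r ler_nat.
- move=> v; rewrite z'E.
  have [/imsetP[i iQ ->]|vu] := boolP (v \in u @: Q).
    rewrite !inE imset_f//= orbT/= (big_pred1 i).
      rewrite mulfV//; have := zD (u i); rewrite (negbTE (uD i)) /=; lra.
    by move=> j; rewrite in_pair_l /= [j == i]eq_sym andbC; case: eqP => //= <-.
  have [/imsetP[i iQ ->]|vw] := boolP (v \in w @: Q).
    rewrite !inE [w i \in w @: Q]imset_f//= orbT/= (big_pred1 i).
      rewrite mulfV//; have := zD (w i); rewrite (negbTE (wD i)) /=; lra.
    by move=> j; rewrite in_pair_r /= [j == i]eq_sym andbC; case: eqP => //= <-.
  rewrite big_pred0 ?mulr0 ?addr0; last first.
    move=> i; apply/negP => /andP[iQ]; rewrite !inE => /orP[]/eqP vE.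
      by move: vu; rewrite vE imset_f.
    by move: vw; rewrite vE imset_f.
  by rewrite (le_trans (zD v))// !inE (negbTE vu) (negbTE vw) !orbF.
- rewrite z'E zq natrD; congr (_ + _); under eq_bigl do rewrite andbT.
  by rewrite sumr_const -[X in _ * X]mulr_natr mulrA mulfV// mul1r.
Qed.

Section Presentation.
Variables (A : algorithm R) (s : seq {set {set V}}).
Hypotheses (fA : feasible A) (us : two_uniform s).

Definition present t := s ++ nseq t pairs.

Lemma presentS t : present t.+1 = rcons (present t) pairs.
Proof. by rewrite /present rcons_cat; congr (_ ++ _); elim: t => //= t <-. Qed.

Lemma two_uniform_present t : two_uniform (present t).
Proof.
elim: t => [|t IH]; first by rewrite /present cats0.
by rewrite presentS; apply: two_uniform_rcons => //; exact: card_pairs.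
Qed.

Definition gain t := \sum_(i < n) @A V (present t.+1) (pair i).

Lemma size_presentS t : size (present t.+1) = (size (present t)).+1.
Proof. by rewrite presentS size_rcons. Qed.

Lemma nth_presentS t : nth set0 (present t.+1) (size (present t)) = pairs.
Proof. by rewrite presentS nth_rcons ltnn eqxx. Qed.

Lemma decision_presentS t :
  decision A (present t.+1) (size (present t)) = @A V (present t.+1).
Proof. by rewrite /decision -size_presentS take_size. Qed.

Lemma decision_present_ge0 t i : 0 <= @A V (present t.+1) (pair i).
Proof.
rewrite -decision_presentS feasible_decision ?size_presentS//.
  exact: two_uniform_present.
by rewrite nth_presentS imset_f.
Qed.

Lemma gain_le1 t : gain t <= 1.
Proof.
have := @feasible_arrival _ _ _ (@two_uniform_present t.+1) A (size (present
  t)) fA.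
rewrite size_presentS nth_presentS decision_presentS => /(_ (leqnn _)).
rewrite (eq_bigl (fun e => (e \in pairs) && true)) ?sum_pairs// => e.
by rewrite andbT.
Qed.

Lemma gained_presentS t : gained A (present t.+1) = gained A (present t) + gain
  t.
Proof.
rewrite /gained {1 2}presentS edge_sum_decision_rcons sum_pairs; congr (_ + _).
by rewrite -presentS.
Qed.

Lemma load_presentS t v : load A (present t.+1) v =
  load A (present t) v + \sum_(i | v \in pair i) @A V (present t.+1) (pair i).
Proof.
by rewrite /load {1 2}presentS edge_sum_decision_rcons sum_pairs presentS.
Qed.

Lemma load_present_ge t v : load A s v <= load A (present t) v.
Proof.
elim: t => [|t IH]; first by rewrite /present cats0.
rewrite load_presentS (le_trans IH)// lerDl sumr_ge0// => i _.
exact: decision_present_ge0.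
Qed.

Lemma sum_load_present_l t : \sum_i load A (present t) (u i) =
  \sum_i load A s (u i) + (gained A (present t) - gained A s).
Proof.
elim: t => [|t IH]; first by rewrite /present cats0 subrr addr0.
under eq_bigr do rewrite load_presentS.
rewrite big_split/= {}IH gained_presentS [X in _ + X = _](_ : _ = gain t);
  first by ring.
apply: eq_bigr => i _; rewrite (big_pred1 i)// => j.
by rewrite in_pair_l eq_sym.
Qed.

Lemma sum_load_present_r t : \sum_i load A (present t) (w i) =
  \sum_i load A s (w i) + (gained A (present t) - gained A s).
Proof.
elim: t => [|t IH]; first by rewrite /present cats0 subrr addr0.
under eq_bigr do rewrite load_presentS.
rewrite big_split/= {}IH gained_presentS [X in _ + X = _](_ : _ = gain t);
  first by ring.
apply: eq_bigr => i _; rewrite (big_pred1 i)// => j.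
by rewrite in_pair_r eq_sym.
Qed.

(** An arrival gains at most 1, so the first time the gain reaches [c] it overshoots by less than 1
    and comes after at least [c] arrivals. *)
Lemma present_until (c : R) T : 0 < c ->
  gained A (present T) < gained A s + c \/
  exists t, [/\ (t <= T)%N, gained A s + c <= gained A (present t),
    gained A (present t) < gained A s + c + 1 & c <= t%:R].
Proof.
move=> c0; elim: T => [|T [IH|[t [tT h1 h2 h3]]]].
- by left; rewrite /present cats0 ltrDl.
- have [|h] := ltP (gained A (present T.+1)) (gained A s + c); first by left.
  right; exists T.+1; split=> //.
    by rewrite gained_presentS; have := gain_le1 T; lra.
  suff : gained A (present T.+1) <= gained A s + T.+1%:R by lra.
  elim: T.+1 => [|k IHk]; first by rewrite /present cats0 addr0.
  by rewrite gained_presentS -natr1; have := gain_le1 k; lra.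
- by right; exists t; split=> //; exact: leqW.
Qed.

End Presentation.
End Pairs.

(** * One phase of the adversary *)

Section Selection.
Variables (R : realType) (I : finType).
Implicit Types (a b : I -> R) (X B Q : {set I}).

Lemma exists_top_subset a X k : (k <= #|X|)%N ->
  exists B, [/\ B \subset X, #|B| = k &
    forall x y, x \in X :\: B -> y \in B -> a x <= a y].
Proof.
elim: k => [|k IHk] kX.
  by exists set0; split; rewrite ?sub0set ?cards0// => x y _; rewrite inE.
have [B [BX Bk aB]] := IHk (ltnW kX).
have /card_gt0P[x0 x0P] : (0 < #|X :\: B|)%N.
  by rewrite cardsD (setIidPr BX) Bk subn_gt0.
case: (@arg_maxP _ _ _ x0 (fun x => x \in X :\: B) a x0P) => x xP xmax.
exists (x |: B); split.
- by rewrite subUset BX sub1set andbT; move: xP; rewrite inE => /andP[].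
- by rewrite cardsU1 Bk; move: xP; rewrite inE => /andP[->].
- move=> y z; rewrite !inE negb_or -andbA => /and3P[yx yB yX] /orP[/eqP->|zB].
    by apply: xmax; rewrite inE yB.
  by apply: aB; rewrite // inE yB.
Qed.

Lemma exists_le_mean b B : (0 < #|B|)%N ->
  exists2 q, q \in B & b q <= (\sum_(i in B) b i) / #|B|%:R.
Proof.
move=> /[dup] B0 /card_gt0P[x0 x0B].
case: (@arg_minP _ _ _ x0 (fun x => x \in B) b x0B) => q qB qmin.
exists q => //; rewrite ler_pdivlMr ?ltr0n// mulr_natr.
by rewrite -sumr_const; apply: ler_sum => i /qmin.
Qed.

(* Cut the elements, sorted by [a], into blocks of size [g] and take in each
   block the element of least [b]: its [a]-value is at most the mean of [a]
   over the next block, so the sums telescope. *)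
Lemma balanced_selection a b X M (g m : nat) : (0 < g)%N ->
  (m * g <= #|X|)%N -> (forall i, i \in X -> 0 <= a i <= M) ->
  (forall i, i \in X -> 0 <= b i) -> 0 <= M ->
  exists Q, [/\ Q \subset X, #|Q| = m,
    \sum_(i in Q) a i <= (\sum_(i in X) a i) / g%:R + M &
    \sum_(i in Q) b i <= (\sum_(i in X) b i) / g%:R].
Proof.
move=> g0; elim: m => [|m IHm] in X M * => mX aM b0 M0.
  exists set0; rewrite sub0set cards0 !big_set0; split=> //.
    rewrite addr_ge0// divr_ge0// sumr_ge0// => i /aM/andP[]//.
  by rewrite divr_ge0// sumr_ge0.
have gX : (g <= #|X|)%N by rewrite (leq_trans _ mX)// mulSn leq_addr.
have [B [BX Bg aB]] := exists_top_subset a gX.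
have splitX (f : I -> R) :
    \sum_(i in X) f i = \sum_(i in B) f i + \sum_(i in X :\: B) f i.
  by rewrite (big_setID B)/= (setIidPr BX).
have [|q qB bq] := @exists_le_mean b B; first by rewrite Bg.
have gR : 0 < g%:R :> R by rewrite ltr0n.
have M'0 : 0 <= (\sum_(i in B) a i) / g%:R.
  by rewrite divr_ge0// sumr_ge0// => i /(subsetP BX)/aM/andP[].
have [|||Q [QX Qm Qa Qb]] := IHm (X :\: B) ((\sum_(i in B) a i) / g%:R) _ _ _
  M'0.
- by rewrite cardsD (setIidPr BX) Bg leq_subRL// -mulSn.
- move=> i iXB; rewrite (andP (aM i _)).1/=; last by move: iXB;
    rewrite inE => /andP[].
  rewrite ler_pdivlMr// -Bg mulr_natr -sumr_const.
  by apply: ler_sum => j jB; exact: aB.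
- by move=> i; rewrite inE => /andP[_ /b0].
have qQ : q \notin Q.
  by apply/negP => /(subsetP QX); rewrite inE qB.
exists (q |: Q); split.
- by rewrite subUset sub1set (subsetP BX)// (subset_trans QX)// subsetDl.
- by rewrite cardsU1 qQ Qm.
- rewrite big_setU1//= splitX mulrDl.
  by have /andP[_] := aM q (subsetP BX _ qB); lra.
- rewrite big_setU1//= splitX mulrDl; move: bq; rewrite Bg; lra.
Qed.

End Selection.

Section Enumeration.
Variable V : finType.

Lemma exists_enum (n : nat) (U : {set V}) : #|U| = n ->
  exists u : 'I_n -> V, injective u /\ U = u @: [set: 'I_n].
Proof.
move=> <-; exists enum_val; split; first exact: enum_val_inj.
apply/setP => v; apply/idP/imsetP => [vU|[i _ ->]]; last exact: enum_valP.
by exists (enum_rank_in vU v); rewrite ?inE// enum_rankK_in.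
Qed.

Lemma imsetTDC (I : finType) (u : I -> V) (Q : {set I}) : injective u ->
  (u @: [set: I]) :\: (u @: (~: Q)) = u @: Q.
Proof.
move=> u_inj; apply/setP => v; rewrite inE; apply/andP/imsetP.
  move=> [vQ /imsetP[i _ vE]]; exists i => //.
  by move: vQ; rewrite vE mem_imset// inE negbK.
move=> [i iQ ->]; rewrite !mem_imset// inE.
by rewrite inE iQ.
Qed.

End Enumeration.

Section Phase.
Variables (R : realType) (V : finType) (A : algorithm R) (g : nat).
Hypotheses (fA : feasible A) (g2 : (2 <= g)%N).
Implicit Types (s : seq {set {set V}}) (D U W B : {set V}) (q : nat).

Let g0 : 0 < g%:R :> R. Proof. by rewrite ltr0n (leq_trans _ g2). Qed.

Definition level (i : nat) : R := i%:R / g%:R.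
Definition level_potential i := potential (level i).
Local Notation F := level_potential.
(** The extra [5 / g] per matched pair pays for the rounding errors of a phase
    ([raise_potential]). *)
Definition ratio_eps : R := opt_ratio R + 5 / g%:R.

Lemma levelS i : level i.+1 = level i + g%:R^-1.
Proof. by rewrite /level -natr1 mulrDl mul1r. Qed.

Lemma level_ge0 i : 0 <= level i.
Proof. by rewrite divr_ge0. Qed.

Lemma level_le1 i : (i <= g)%N -> level i <= 1.
Proof. by move=> ig; rewrite ler_pdivrMr// mul1r ler_nat. Qed.

Lemma invg_le : g%:R^-1 <= 1 / 2 :> R.
Proof. by rewrite -div1r ler_pdivrMr// mulrAC ler_pdivlMr// !mul1r ler_nat. Qed.

Lemma level_potential0 : F 0 = 0.
Proof. by rewrite /level_potential /level mul0r potential0. Qed.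

Lemma level_potential_ge0 i : 0 <= F i.
Proof. exact/potential_ge0/level_ge0. Qed.

Lemma level_potential_le1 i : (i <= g)%N -> F i <= 1.
Proof.
move=> /level_le1/potential_le; rewrite potential1.
by have := opt_ratio_lt1 R; rewrite /level_potential; lra.
Qed.

Lemma level_potential_add i j : (i + j <= g)%N -> F i + F j <= opt_ratio R.
Proof.
move=> ij; apply: potential_add_le; rewrite ?level_ge0//.
by rewrite -mulrDl -natrD level_le1.
Qed.

(** Tangent at [level i]: the left side is its price divided by [g]. *)
Lemma level_potentialS_ge i :
  (F i + (1 - opt_ratio R) / 2) / g%:R <= F i.+1 - F i.
Proof.
have := potential_convex (level i.+1) (level i).
by rewrite -/(F i) -/(F i.+1) [F i]potential_price subrK levelS; lra.
Qed.

Lemma level_potentialS_le i : (i <= g)%N -> F i.+1 - F i <= 2 / g%:R.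
Proof.
move=> /level_le1 i1; have := potential_convex (level i) (level i.+1).
(* For [i = g] the level exceeds 1, so [price_le1] is applied at level [i], and [expR g%:R^-1] is at
   most 2 because [g >= 2]. *)
have : price (level i.+1) <= 2.
  have := price_le1 i1; have := price_gt0 (level i).
  rewrite levelS /price expRD -!mulrA [expR g%:R^-1 * _]mulrC !mulrA.
  have : (1 - g%:R^-1) * expR g%:R^-1 <= 1 :> R.
    have := expR_ge1Dx (- g%:R^-1 : R); rewrite expRN => h.
    by rewrite -ler_pdivlMr ?expR_gt0// div1r.
  have := expR_gt0 (g%:R^-1 : R); have := invg_le.
  move: (expR g%:R^-1) => E h2 E0 hE p0 p1.
  have E2 : E <= 2 by nra.
  by nra.
have -> : level i.+1 - level i = g%:R^-1 by rewrite levelS addrC addKr.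
rewrite -/(F i) -/(F i.+1) => p2 /le_trans; apply.
by rewrite ler_pM2r// invr_gt0.
Qed.

(* [tau] absorbs the rounding errors of the phases undergone by [B]. *)
Definition loaded s B i (tau : nat) :=
  #|B|%:R * level i - tau%:R <= \sum_(v in B) load A s v.

(** Here [m] is about [n / g]. Raising [n] pairs adds at least [(1 - r + F i + F j) n / g] of
    potential, and [m] matched pairs yield [(r - F i - F j) m]: together [n / g]. Of the slack
    [5 m / g], a part [4 m / g] covers the raise that matched pairs do not receive, and [m / g >= 3]
    covers the rounding of [m] (at most 2) and the overshoot 1. *)
Lemma raise_potential (n m i j : nat) : (m * g <= n)%N ->
  (n <= (m + 2) * g)%N -> (3 * g <= m)%N -> (i + j <= g)%N ->
  n%:R / g%:R + 1 <=
  ratio_eps * m%:R + (n - m)%:R * (F i.+1 + F j.+1) - n%:R * (F i + F j).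
Proof.
move=> mn nm gm ij.
have mLn : (m <= n)%N by rewrite (leq_trans _ mn)// leq_pmulr//
  (leq_trans _ g2).
have [ig jg] : (i <= g)%N /\ (j <= g)%N by lia.
have := level_potential_add ij.
have := level_potential_ge0 i; have := level_potential_ge0 j.
have := level_potentialS_ge i; have := level_potentialS_ge j.
have := level_potentialS_le ig; have := level_potentialS_le jg.
have := opt_ratio_gt0 R; have := opt_ratio_lt1 R.
set r := opt_ratio R; rewrite natrB// /ratio_eps -/r.
move: (F i) (F j) (F i.+1) (F j.+1) => a b a' b' r1 r0 hb ha hb' ha' b0 a0 ab.
set h := g%:R^-1 : R in ha hb ha' hb' *.
have h0 : 0 < h by rewrite invr_gt0.
have mR : m%:R <= n%:R * h by rewrite ler_pdivlMr// -natrM ler_nat.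
have nR : n%:R * h <= m%:R + 2 by rewrite ler_pdivrMr// -natrD -natrM ler_nat.
have gR : 3 <= m%:R * h by rewrite ler_pdivlMr// -natrM ler_nat.
move: (m%:R : R) (n%:R : R) mR nR gR => x y mR nR gR.
have y0 : 0 <= y.
  by rewrite -(pmulr_lge0 _ h0) mulrC; nra.
have h1 : y * ((a + b + (1 - r)) * h) <= y * (a' + b' - (a + b)).
  by rewrite ler_wpM2l//; lra.
have x0 : 0 <= x by nra.
have h2 : x * (a' + b' - (a + b)) <= x * (4 * h) by rewrite ler_wpM2l//; lra.
have h3 : (y * h - x) * (r - (a + b)) <= 2 * 1.
  by rewrite ler_pM//; lra.
rewrite -subr_ge0.
have -> : (r + 5 * h) * x + (y - x) * (a' + b') - y * (a + b) - (y * h + 1) =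
  (y * (a' + b' - (a + b)) - y * ((a + b + (1 - r)) * h))
  + (x * (4 * h) - x * (a' + b' - (a + b)))
  + (2 - (y * h - x) * (r - (a + b))) + (x * h - 3).
  ring.
by lra.
Qed.

(** Removing a [1 / g] share of the total load [S] keeps the nominal mean. Five units cover the
    additive error 1 of the selection and the gap, at most 2, between [m] and [n / g], which is
    multiplied by a level of at most 3/2. *)
Lemma raise_loaded (n m i tau : nat) (S K : R) : (m * g <= n)%N ->
  (n <= (m + 2) * g)%N -> (i <= g)%N ->
  n%:R * level i - tau%:R + n%:R / g%:R <= S ->
  S - (S / g%:R + 1) <= K ->
  (n - m)%:R * level i.+1 - (tau + 5)%:R <= K.
Proof.
move=> mn nm ig nS SK.
have mLn : (m <= n)%N by rewrite (leq_trans _ mn)// leq_pmulr//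
  (leq_trans _ g2).
apply: le_trans SK; move: nS; rewrite natrB// natrD levelS => nS.
have := level_le1 ig; have := level_ge0 i; have := invg_le.
have h0 : 0 < g%:R^-1 :> R by rewrite invr_gt0.
have mR : m%:R <= n%:R / g%:R :> R by rewrite ler_pdivlMr// -natrM ler_nat.
have nR : n%:R / g%:R <= m%:R + 2 :> R.
  by rewrite ler_pdivrMr// -natrD -natrM ler_nat.
have t0 : 0 <= tau%:R :> R by [].
move: (g%:R^-1 : R) (level i) (tau%:R : R) nS h0 mR nR t0 =>
  h l t nS h0 mR nR t0.
move: (n%:R : R) (m%:R : R) nS mR nR => x y nS mR nR hl l0 l1.
have h1 : 0 <= (S - (x * l - t + x * h)) * (1 - h) by rewrite mulr_ge0//; lra.
have h2 : 0 <= (2 - (x * h - y)) * (l + h) by rewrite mulr_ge0//; lra.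
have h3 : 0 <= t * h by rewrite mulr_ge0//; lra.
nra.
Qed.

(** The pairs are shown at most [n] times. If the gain stays below [n / g], the [n] repetitions
    carry all [n] pairs offline. Otherwise the phase stops after at least [n / g >= m] arrivals,
    enough to carry [m] pairs. *)
Lemma phase s D q U W (n m i j tau tau' : nat) :
  two_uniform s -> packing R s D q -> #|U| = n -> #|W| = n ->
  [disjoint U & W] -> [disjoint U & D] -> [disjoint W & D] ->
  (m * g <= n)%N -> (n <= (m + 2) * g)%N -> (3 * g <= m)%N ->
  (i + j <= g)%N -> loaded s U i tau -> loaded s W j tau' ->
  exists s', [/\ two_uniform s', forall v, load A s v <= load A s' v &
  packing R s' (D :|: U :|: W) (q + n) /\
    gained A s' <= gained A s + ratio_eps * n%:R - n%:R * (F i + F j)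
  \/
  exists U' W', [/\ U' \subset U, W' \subset W, #|U'| = (n - m)%N,
    #|W'| = (n - m)%N &
    [/\ packing R s' (D :|: (U :\: U') :|: (W :\: W')) (q + m),
      gained A s' <= gained A s + ratio_eps * m%:R +
        (n - m)%:R * (F i.+1 + F j.+1) - n%:R * (F i + F j),
      loaded s' U' i.+1 (tau + 5) & loaded s' W' j.+1 (tau' + 5)]]].
Proof.
move=> us pD Un Wn UW UD WD mn nm gm ij lU lW.
have [u [u_inj UE]] := exists_enum Un.
have [w [w_inj WE]] := exists_enum Wn.
have uU k : u k \in U by rewrite UE imset_f.
have wW k : w k \in W by rewrite WE imset_f.
have uw k l : u k != w l.
  by apply: contraTneq (uU k) => ->; rewrite (disjointFl UW).
have uD k : u k \notin D by rewrite (disjointFr UD).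
have wD k : w k \notin D by rewrite (disjointFr WD).
have ig : (i <= g)%N := leq_trans (leq_addr j i) ij.
have jg : (j <= g)%N := leq_trans (leq_addl i j) ij.
have mLn : (m <= n)%N by rewrite (leq_trans _ mn)// leq_pmulr//
  (leq_trans _ g2).
have n0 : (0 < n)%N by rewrite (leq_trans _ mLn)// (leq_trans _ gm)//
  muln_gt0/= (leq_trans _ g2).
have c0 : 0 < n%:R / g%:R :> R by rewrite divr_gt0// ltr0n.
have sumU (Q : {set 'I_n}) f : \sum_(v in u @: Q) f v = \sum_(k in Q) f (u k)
  :> R.
  by rewrite big_imset//= => ? ? _ _; exact: u_inj.
have sumW (Q : {set 'I_n}) f : \sum_(v in w @: Q) f v = \sum_(k in Q) f (w k)
  :> R.
  by rewrite big_imset//= => ? ? _ _; exact: w_inj.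
have sumT (f : 'I_n -> R) : \sum_(k in [set: 'I_n]) f k = \sum_k f k.
  by apply: eq_bigl => k; rewrite inE.
case: (present_until u_inj uw fA us n c0) => [kill|[t [tn h1 h2 h3]]].
  exists (present u w s n); split.
  - exact: two_uniform_present.
  - by move=> v; exact: load_present_ge.
  left; split.
    rewrite {1}UE {1}WE -[X in (q + X)%N]card_ord -cardsT.
    by apply: packing_pairs => //; rewrite cardsT card_ord.
  apply: le_trans (ltW kill) _; rewrite -addrA lerD2l /ratio_eps mulrDl.
  have := level_potential_add ij; move: c0.
  have : 0 < n%:R :> R by rewrite ltr0n.
  by move=> ? ? ?; nra.
set s' := present u w s t in h1 h2.
have us' : two_uniform s' by exact: two_uniform_present.
have ss' v : load A s v <= load A s' v by exact: load_present_ge.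
have load0 v : 0 <= load A s' v.
  rewrite /load sumr_ge0// => k _; rewrite sumr_ge0// => e /andP[ek _].
  exact: (feasible_decision us').
have load1 v : load A s' v <= 1 by exact: feasible_load.
(* The matched pairs must take no more than about a [1 / g] share of the load on both sides at once;
   loads are at most 1, whence the bound [M = 1]. *)
have [||||Q [_ Qm]] := @balanced_selection R _
  (fun k => load A s' (u k)) (fun k => load A s' (w k))
  [set: 'I_n] 1 g m (leq_trans (isT : (0 < 2)%N) g2).
- by rewrite cardsT card_ord.
- by move=> k _; rewrite load0 load1.
- by move=> k _.
- by [].
rewrite !sumT (sum_load_present_l u_inj uw) (sum_load_present_r u_inj w_inj uw)
  -/s' => QU QW.
have compl (f : 'I_n -> R) : \sum_(k in ~: Q) f k = \sum_k f k - \sum_(k in Q)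
  f k.
  by rewrite -sumT [X in _ = X - _](big_setID Q)/= setTI setTD addrAC subrr
    add0r.
have cardC : #|~: Q| = (n - m)%N by rewrite cardsCs setCK Qm card_ord.
exists s'; split=> //; right; exists (u @: (~: Q)), (w @: (~: Q)); split.
- by rewrite UE imsetS// subsetT.
- by rewrite WE imsetS// subsetT.
- by rewrite card_imset.
- by rewrite card_imset.
split.
- rewrite UE WE !imsetTDC// -Qm; apply: packing_pairs => //.
  by rewrite -(ler_nat R) (le_trans _ h3)// Qm ler_pdivlMr// -natrM ler_nat.
- by have := raise_potential mn nm gm ij; move: h2; lra.
- rewrite /loaded card_imset// cardC sumU compl.
  rewrite (sum_load_present_l u_inj uw) -/s'.
  apply: (raise_loaded mn nm ig _ (lerB (lexx _) QU)).
  by move: lU; rewrite /loaded Un UE sumU sumT; lra.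
- rewrite /loaded card_imset// cardC sumW compl.
  rewrite (sum_load_present_r u_inj w_inj uw) -/s'.
  apply: (raise_loaded mn nm jg _ (lerB (lexx _) _)).
    by move: lW; rewrite /loaded Wn WE sumW sumT; lra.
  by move: QW; lra.
Qed.

End Phase.

Ltac case_membership v :=
  repeat match goal with |- context [in_mem v ?X] => case: (in_mem v X) end;
    by [].

(** * Raising fresh nodes to a given level *)

Section Production.
Variables (R : realType) (V : finType) (A : algorithm R) (g : nat).
Hypotheses (fA : feasible A) (g2 : (2 <= g)%N).
Implicit Types (s : seq {set {set V}}) (D U W B : {set V}) (q : nat).
Local Notation F := (level_potential R g).
Local Notation ld := (loaded A g).

Lemma load_ge0 s v : two_uniform s -> 0 <= load A s v.
Proof.
move=> us; apply: sumr_ge0 => k _; apply: sumr_ge0 => e /andP[ek _].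
exact: feasible_decision ek.
Qed.

Lemma loaded_mono s s' B i tau tau' : (forall v, load A s v <= load A s' v) ->
  (tau <= tau')%N -> ld s B i tau -> ld s' B i tau'.
Proof.
move=> ss' tt; rewrite /loaded => h.
apply: le_trans (ler_sum _ (fun v _ => ss' v)); apply: le_trans h.
by rewrite lerD2l lerN2 ler_nat.
Qed.

Lemma loadedU s B B' i tau tau' : [disjoint B & B'] ->
  ld s B i tau -> ld s B' i tau' -> ld s (B :|: B') i (tau + tau')%N.
Proof.
move=> BB'; rewrite /loaded cardsU (disjoint_setI0 BB') cards0 subn0 => h h'.
rewrite (eq_bigl _ _ (fun v => in_setU v B B')) bigU//= !natrD mulrDl; lra.
Qed.

Lemma loaded0 s B tau : two_uniform s -> ld s B 0 tau.
Proof.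
move=> us; rewrite /loaded /level mul0r mulr0 sub0r.
by rewrite (@le_trans _ _ 0)// ?oppr_le0// sumr_ge0// => v _; exact: load_ge0.
Qed.

Lemma loaded_set0 s i tau : ld s set0 i tau.
Proof. by rewrite /loaded cards0 big_set0 mul0r sub0r oppr_le0. Qed.

(** The number of pairs still in play after a phase on [n] pairs that matches [n %/ g] of them. *)
Definition shrink n := (n - n %/ g)%N.

Lemma shrink_le n : (shrink n <= n)%N.
Proof. exact: leq_subr. Qed.

Lemma leq_double_shrink n : (n <= 2 * shrink n)%N.
Proof.
have : (n %/ g <= n %/ 2)%N by apply: leq_div2l.
by rewrite /shrink; lia.
Qed.

(** [shrink] grows by at most 1 at each step, so the least [n] reaching [p] hits it exactly. This
    allows the size of a production to be planned backwards. *)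
Lemma shrink_onto p : exists2 n, shrink n = p & (n <= 2 * p)%N.
Proof.
have ex : exists n, (p <= shrink n)%N.
  by exists (2 * p)%N; have := leq_double_shrink (2 * p); lia.
case: (ex_minnP ex) => n pn nmin; exists n.
  apply/eqP; rewrite eqn_leq pn andbT.
  case: n pn nmin => [|n] pn nmin; first by rewrite /shrink sub0n.
  rewrite leqNgt; apply/negP => lt_p; have := nmin n.
  have : (n %/ g <= n.+1 %/ g)%N by apply: leq_div2r.
  move: lt_p; rewrite /shrink; have := leq_div n g; lia.
by apply: nmin; have := leq_double_shrink (2 * p); lia.
Qed.

Lemma leq_div2_mul n : (n <= (n %/ g + 2) * g)%N.
Proof.
apply: ltnW; apply: leq_trans (ltn_ceil n (leq_trans (isT : (0 < 2)%N) g2)) _.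
by rewrite leq_mul2r -addn1 leq_add2l orbT.
Qed.

(** Phases [(0, 0)], ..., [(i - 1, i - 1)] in succession; the initial size is found from the final
    size [p] by inverting [shrink], which at most doubles it each time. The bound [p + i <= p0]
    ensures offline progress as soon as [i > 0]. *)
Lemma produce (i : nat) : (i.*2 <= g)%N -> forall p, (3 * g * g <= p)%N ->
  exists p0, [/\ (p + i <= p0)%N, (p0 <= 2 ^ i * p)%N &
  forall s D q U W, two_uniform s -> packing R s D q ->
  #|U| = p0 -> #|W| = p0 ->
  [disjoint U & W] -> [disjoint U & D] -> [disjoint W & D] ->
  exists s', [/\ two_uniform s', forall v, load A s v <= load A s' v &
  packing R s' (D :|: U :|: W) (q + p0) /\
    gained A s' <= gained A s + ratio_eps R g * p0%:R
  \/
  exists U' W', [/\ U' \subset U, W' \subset W, #|U'| = p, #|W'| = p &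
    [/\ packing R s' (D :|: (U :\: U') :|: (W :\: W')) (q + (p0 - p)),
      gained A s' <= gained A s + ratio_eps R g * (p0 - p)%:R +
        p%:R * (F i + F i),
      ld s' U' i (5 * i)%N & ld s' W' i (5 * i)%N]]]].
Proof.
elim: i => [|i IHi] ig p gp.
  exists p; rewrite addn0 expn0 mul1n; split=> //
    s D q U W us pD Up Wp UW UD WD.
  exists s; split=> //; right; exists U, W; split=> //; split.
  - by rewrite !setDv !setU0 subnn addn0.
  - by rewrite subnn level_potential0 addr0 !mulr0 !addr0.
  - exact: loaded0.
  - exact: loaded0.
have [p1 p1p p1le] := shrink_onto p.
have pp1 : (p <= p1)%N by rewrite -p1p shrink_le.
have gm : (3 * g <= p1 %/ g)%N.
  by rewrite leq_divRL ?(leq_trans _ g2)// (leq_trans gp).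
have pE : (p = p1 - p1 %/ g)%N by [].
have m_le : (p1 %/ g <= p1)%N by exact: leq_div.
have [|p0 [p1p0 p0le IH]] := IHi _ p1 (leq_trans gp pp1); first by lia.
have p01 : (p1 <= p0)%N by rewrite (leq_trans _ p1p0)// leq_addr.
have q1 : (p0 - p = p0 - p1 + p1 %/ g)%N 
  by clear -pE m_le p01; move: (p1 %/ g)%N pE m_le => m -> ?; lia.
exists p0; split.
  clear -p1p0 pE gm m_le g2.
  by move: (p1 %/ g)%N pE gm m_le => m -> gm m_le; lia.
  by rewrite (leq_trans p0le)// expnS -mulnA mulnCA leq_mul2l p1le orbT.
move=> s D q U W us pD Up Wp UW UD WD.
have [s1 [us1 ss1 [kill|[U1 [W1 [U1U W1W U1p W1p [pD1 g1 lU lW]]]]]]] :=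
  IH s D q U W us pD Up Wp UW UD WD.
  by exists s1; split=> //; left.
have dis1 (X Y X' Y' : {set V}) : X' \subset X -> [disjoint X & Y] -> [disjoint
  X & D] ->
    [disjoint X' & D :|: (X :\: X') :|: (Y :\: Y')].
  move=> /subsetP XX' /disjointFr XY /disjointFr XD.
  apply/pred0P => v /=; apply/negP => /andP[vX']; have vX := XX' _ vX'.
  by rewrite !inE XD// XY// vX' andbF.
have UW1 : [disjoint U1 & W1] by exact: disjointW UW.
have UD1 := dis1 U W U1 W1 U1U UW UD.
have WD1 : [disjoint W1 & D :|: (U :\: U1) :|: (W :\: W1)].
  by rewrite setUAC; apply: dis1 => //; rewrite disjoint_sym.
have [|||s2 [us2 ss2 res]] := phase (m :=
  p1 %/ g) fA g2 us1 pD1 U1p W1p UW1 UD1 WD1 _ _ gm _ lU lW.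
- exact: leq_divM.
- exact: leq_div2_mul.
- by rewrite addnn (leq_trans _ ig)// doubleS -addn2 leq_addr.
exists s2; split=> // [v|]; first exact: le_trans (ss1 v) (ss2 v).
case: res => [[pD2 g2le]|[U2 [W2 [U2U W2W U2p W2p [pD2 g2le lU2 lW2]]]]];
  [left|right].
  split.
    move: pD2; rewrite -addnA subnK//.
    congr packing; apply/setP => v; rewrite !inE.
    move/subsetP/(_ v)/implyP: U1U; move/subsetP/(_ v)/implyP: W1W.
    by case_membership v.
  move: g2le g1; rewrite natrB//.
  by lra.
exists U2, W2; split; rewrite ?pE//.
- exact: subset_trans U2U U1U.
- exact: subset_trans W2W W1W.
rewrite -pE; split.
- rewrite q1 addnA.
  move: pD2; congr packing; apply/setP => v; rewrite !inE.
  move/subsetP/(_ v)/implyP: U1U; move/subsetP/(_ v)/implyP: W1W.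
  move/subsetP/(_ v)/implyP: U2U; move/subsetP/(_ v)/implyP: W2W.
  by case_membership v.
- move: g2le g1; rewrite -pE.
  by rewrite q1 natrD; lra.
- by rewrite mulnS addnC.
- by rewrite mulnS addnC.
Qed.

End Production.

(** * The adversary's strategy *)

Section State.
Variables (R : realType) (V : finType) (A : algorithm R) (g : nat).
Hypotheses (fA : feasible A) (g2 : (2 <= g)%N).
Implicit Types (s : seq {set {set V}}) (D U W B : {set V}) (q : nat).
Implicit Types lab : V -> nat.
Local Notation F := (level_potential R g).
Local Notation ld := (loaded A g).

(* Label [i <= g] is the nominal load [i / g] of a node still in play (fresh
   nodes have label 0); label [g.+1] marks the nodes matched by the offline
   solution. *)
Definition cls lab (i : nat) : {set V} := [set v | lab v == i].
Definition label_potential i : R := if (i <= g)%N then F i else 0.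

(** The invariant of the adversary. The exact number of matched nodes serves to count how many fresh
    nodes remain. *)
Definition state s lab q :=
  [/\ two_uniform s, packing R s (cls lab g.+1) q, #|cls lab g.+1| = q.*2,
      gained A s <= ratio_eps R g * q%:R + \sum_v label_potential (lab v) &
      forall v, (lab v <= g.+1)%N].

Definition relabel lab U W U' W' x y : V -> nat := fun v =>
  if v \in U' then x else if v \in W' then y else
  if v \in U :|: W then g.+1 else lab v.

Lemma cls_relabel lab U W U' W' x y i : [disjoint U & W] ->
  U' \subset U -> W' \subset W -> (i <= g)%N ->
  cls (relabel lab U W U' W' x y) i =
  cls lab i :\: (U :|: W) :|: (if i == x then U' else set0)
    :|: (if i == y then W' else set0).
Proof.
move=> /disjointFr UW /subsetP UU /subsetP WW ig; apply/setP => v.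
rewrite !inE /relabel inE.
have [vU'|vU'] := boolP (v \in U').
  have vU := UU _ vU'; rewrite vU/= (_ : v \in (if i == y then W' else _) =
    false); last first.
    by case: ifP => _; rewrite ?inE//; apply/negP => /WW; rewrite UW.
  by rewrite orbF eq_sym; case: ifP; rewrite ?vU' ?inE.
rewrite (_ : v \in (if i == x then U' else _) = false); last first.
  by case: ifP => _; rewrite ?inE//; exact: negbTE.
rewrite orbF; have [vW'|vW'] := boolP (v \in W').
  by rewrite (WW _ vW') orbT/= eq_sym; case: ifP; rewrite ?vW' ?inE.
rewrite (_ : v \in (if i == y then W' else _) = false); last first.
  by case: ifP => _; rewrite ?inE//; exact: negbTE.
rewrite orbF; case: ifP => //= _.
by apply/negP => /eqP gi; move: ig; rewrite -gi ltnn.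
Qed.

Lemma dead_relabel lab U W U' W' x y i j : [disjoint U & W] ->
  U \subset cls lab i -> W \subset cls lab j -> (i <= g)%N -> (j <= g)%N ->
  U' \subset U -> W' \subset W -> (x <= g)%N -> (y <= g)%N ->
  cls (relabel lab U W U' W' x y) g.+1 =
  cls lab g.+1 :|: (U :\: U') :|: (W :\: W').
Proof.
move=> /disjointFr UW /subsetP Ui /subsetP Wj ig jg /subsetP UU /subsetP WW xg
  yg.
apply/setP => v; rewrite !inE /relabel inE.
have [vU'|vU'] := boolP (v \in U').
  have vU := UU _ vU'; have := Ui _ vU; rewrite inE => /eqP->.
  by rewrite (UW _ vU) [x == _]ltn_eqF// [i == _]ltn_eqF//= andbF.
have [vW'|vW'] := boolP (v \in W').
  have /Wj := WW _ vW'; rewrite inE => /eqP->.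
  rewrite [y == _]ltn_eqF// [j == _]ltn_eqF//= orbF.
  by apply/esym/negP => /UW; rewrite WW.
by rewrite /=; case: (v \in U); case: (v \in W); rewrite ?eqxx ?orbT ?orbF.
Qed.

Lemma label_potential_relabel lab U W U' W' x y i j : [disjoint U & W] ->
  U \subset cls lab i -> W \subset cls lab j -> (i <= g)%N -> (j <= g)%N ->
  U' \subset U -> W' \subset W -> (x <= g)%N -> (y <= g)%N ->
  \sum_v label_potential (relabel lab U W U' W' x y v) =
  \sum_v label_potential (lab v) + #|U'|%:R * F x + #|W'|%:R * F y
    - #|U|%:R * F i - #|W|%:R * F j.
Proof.
move=> /disjointFr UW /subsetP Ui /subsetP Wj ig jg /subsetP UU /subsetP WW xg
  yg.
have card_mul B c : #|B|%:R * c = \sum_v (if v \in B then c else 0) :> R.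
  by rewrite -big_mkcond/= sumr_const mulr_natl.
rewrite !card_mul -!sumrN -!big_split/=; apply: eq_bigr => v _.
rewrite /relabel inE.
have [vU'|vU'] := boolP (v \in U').
  have vU := UU _ vU'; have := Ui _ vU; rewrite inE => /eqP->.
  have vW := UW _ vU.
  rewrite vU vW (_ : v \in W' = false); last by apply/negP => /WW; rewrite vW.
  by rewrite /label_potential xg ig; ring.
have [vW'|vW'] := boolP (v \in W').
  have vW := WW _ vW'; have := Wj _ vW; rewrite inE => /eqP->.
  rewrite vW (_ : v \in U = false); last by apply/negP => /UW; rewrite vW.
  by rewrite /label_potential yg jg; ring.
have [vU|vU] := boolP (v \in U).
  have := Ui _ vU; rewrite inE => /eqP->; rewrite UW//=.
  by rewrite /label_potential ltnn ig; ring.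
have [vW|vW] := boolP (v \in W).
  have := Wj _ vW; rewrite inE => /eqP->.
  by rewrite /label_potential ltnn jg; ring.
by rewrite /=; ring.
Qed.

Lemma state_relabel s lab q s' U W U' W' x y i j k : state s lab q ->
  [disjoint U & W] ->
  U \subset cls lab i -> W \subset cls lab j -> (i <= g)%N -> (j <= g)%N ->
  U' \subset U -> W' \subset W -> (x <= g)%N -> (y <= g)%N ->
  two_uniform s' -> #|U :\: U'| = k -> #|W :\: W'| = k ->
  packing R s' (cls lab g.+1 :|: (U :\: U') :|: (W :\: W')) (q + k) ->
  gained A s' <= gained A s + ratio_eps R g * k%:R + #|U'|%:R * F x +
    #|W'|%:R * F y - #|U|%:R * F i - #|W|%:R * F j ->
  state s' (relabel lab U W U' W' x y) (q + k).
Proof.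
move=> [us ps cq gs lg] UW Ui Wj ig jg UU WW xg yg us' Uk Wk ps' gs'.
split=> //.
- by rewrite (dead_relabel UW Ui Wj).
- rewrite (dead_relabel UW Ui Wj)//.
  move/disjointFr in UW; move/subsetP in Ui; move/subsetP in Wj.
  have disj (X : {set V}) : X \subset cls lab i \/ X \subset cls lab j ->
      cls lab g.+1 :&: X = set0.
    move=> Xij; apply/eqP; rewrite setI_eq0 disjoint_sym.
    apply/pred0P => v /=; apply/negP => /andP[vX]; rewrite inE => /eqP vg.
    by case: Xij => /subsetP/(_ _ vX); rewrite inE vg => /eqP gE;
      [move: ig|move: jg]; rewrite -gE ltnn.
  have E : (cls lab g.+1 :|: (U :\: U')) :&: (W :\: W') = set0.
    rewrite setIUl disj; last by right; apply/subsetP => v /setDP[/Wj].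
    rewrite set0U; apply/setP => v; rewrite !inE; apply/negP.
    by move=> /andP[/andP[_ vU] /andP[_ vW]]; rewrite UW in vW.
  rewrite cardsU E.
  rewrite cards0 subn0 cardsU disj; last first.
    by left; apply/subsetP => v /setDP[/Ui].
  by rewrite cards0 subn0 Uk Wk cq; lia.
- rewrite (label_potential_relabel UW Ui Wj)// natrD mulrDr.
  by move: gs gs'; lra.
- move=> v; rewrite /relabel; case: ifP => _; first exact: leqW.
  by case: ifP => _; [exact: leqW|case: ifP].
Qed.

(** Nodes that are not fresh are either matched, [q.*2] of them, or in one of [g] bounded classes;
    thus fresh nodes cannot run out before [q] is large. *)
Lemma card_fresh s lab q N : state s lab q ->
  (forall i, (1 <= i <= g)%N -> (#|cls lab i| <= N)%N) ->
  (#|V| <= #|cls lab 0| + q.*2 + g * N)%N.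
Proof.
move=> [_ _ cq _ lg] cN.
have -> : #|V| = (\sum_(i < g.+2) #|cls lab i|)%N.
  rewrite -sum1_card (partition_big (fun v =>
    inord (lab v) : 'I_g.+2) xpredT)//=.
  apply: eq_bigr => i _; rewrite -sum1_card; apply: eq_bigl => v.
  by rewrite inE -val_eqE/= inordK// ltnS.
rewrite big_ord_recl big_ord_recr/= cq -addnA leq_add2l addnC leq_add2l.
rewrite -[X in (_ <= X * _)%N](card_ord g) -sum_nat_const;
  apply: leq_sum => i _.
by apply: cN; rewrite /bump/= add1n ltn_ord.
Qed.

(** Fresh and matched nodes contribute nothing, so the potential is bounded independently of [q]. *)
Lemma label_potential_le s lab q N : state s lab q ->
  (forall i, (1 <= i <= g)%N -> (#|cls lab i| <= N)%N) ->
  \sum_v label_potential (lab v) <= (g * N)%:R.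
Proof.
move=> [_ _ cq _ lg] cN.
rewrite (partition_big (fun v => inord (lab v) : 'I_g.+2) xpredT)//=.
have E (i : 'I_g.+2) : \sum_(v | inord (lab v) == i) label_potential (lab v) =
    #|cls lab i|%:R * label_potential i.
  rewrite (eq_bigl (fun v => v \in cls lab i)).
    rewrite (eq_bigr (fun=> label_potential i)) ?sumr_const ?mulr_natl// => v.
    by rewrite inE => /eqP->.
  by move=> v; rewrite inE -val_eqE/= inordK// ltnS.
under eq_bigr do rewrite E.
rewrite big_ord_recl big_ord_recr/= {1 3}/label_potential leq0n ltnn.
rewrite level_potential0 !mulr0 add0r addr0.
rewrite natrM -[X in _ <= X%:R * _](card_ord g) mulr_natl -sumr_const.
apply: ler_sum => i _; rewrite /bump/= add1n /label_potential ltn_ord.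
rewrite -[leRHS]mulr1 ler_pM ?level_potential_ge0 ?level_potential_le1//.
by rewrite ler_nat cN//= ltn_ord.
Qed.

End State.

(** * The rounds of the adversary *)

Section Strategy.
Variables (R : realType) (V : finType) (A : algorithm R) (J n0 : nat).
Hypotheses (fA : feasible A) (J1 : (1 <= J)%N).
Local Notation g := (J.*2).
Local Notation F := (level_potential R g).
Local Notation ld := (loaded A g).
Implicit Types (s : seq {set {set V}}) (U W B : {set V}) (q : nat).
Implicit Types lab : V -> nat.

Let g2 : (2 <= g)%N. Proof. by rewrite -addnn (leq_add J1 J1). Qed.

(* Half the number of nodes that reach level [J + k] in a round without being
   matched offline. *)
Definition cohort k := iter k (shrink g) n0.

(** After division by [g], the term [3 * g * g] serves the productions and phases, and
    [5 * g.+1 ^ 2 + 6] exceeds the load error accumulated by a cohort ([overload]). *)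
Hypothesis cohort_large : forall k, (k <= J)%N ->
  (g * (3 * g * g + 5 * g.+1 ^ 2 + 6) <= cohort k)%N.

Lemma cohortS k : cohort k.+1 = (cohort k - cohort k %/ g)%N. Proof. by []. Qed.

Lemma cohort_anti k l : (k <= l)%N -> (cohort l <= cohort k)%N.
Proof.
move=> /subnK <-; elim: (l - k)%N => // m IH.
by rewrite addSn (leq_trans _ IH)// shrink_le.
Qed.

Lemma cohort_divg k : (k <= J)%N -> (3 * g * g + 5 * g.+1 ^ 2 + 6 <=
  cohort k %/ g)%N.
Proof. by move=> /cohort_large; rewrite leq_divRL 1?mulnC//; lia. Qed.

Lemma cls_setD lab U a i : U \subset cls lab a -> a != i ->
  cls lab i :\: U = cls lab i.
Proof.
move=> /subsetP Ua ai; apply/setDidPl/pred0P => v /=; apply/negP.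
by rewrite inE => /andP[/eqP vi /Ua]; rewrite inE vi eq_sym (negbTE ai).
Qed.

Lemma disjoint_cls lab U W a b : U \subset cls lab a -> W \subset cls lab b ->
  a != b -> [disjoint U & W].
Proof.
move=> /subsetP Ua /subsetP Wb ab; apply/pred0P => v /=; apply/negP.
move=> /andP[/Ua + /Wb]; rewrite !inE => /eqP-> /eqP E.
by rewrite E eqxx in ab.
Qed.

Lemma exists_subset (X : {set V}) k : (k <= #|X|)%N ->
  exists2 U : {set V}, U \subset X & #|U| = k.
Proof.
move=> kX; have [U [UX Uk _]] := exists_top_subset (fun=> 0 : R) kX.
by exists U.
Qed.

(** Tops up class [l] by producing [p] pairs from fresh nodes; both sides of the pairs join the
    class, each with error [5 * l]. If the production fails, its pairs are all matched offline and
    the class is unchanged. *)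
Lemma fill s lab q l c p : state A g s lab q -> (1 <= l <= J)%N ->
  #|cls lab l| = c.*2 -> ld s (cls lab l) l (5 * l ^ 2)%N ->
  (3 * g * g <= p)%N -> ((2 ^ J * p).*2 <= #|cls lab 0|)%N ->
  exists s' lab' q', [/\ state A g s' lab' q',
    forall v, load A s v <= load A s' v, (q < q')%N,
    forall i, (1 <= i <= g)%N -> i != l -> cls lab' i = cls lab i &
    cls lab' l = cls lab l \/
    #|cls lab' l| = (c + p).*2 /\
      ld s' (cls lab' l) l (5 * l ^ 2 + 10 * l)%N].
Proof.
move=> st /andP[l1 lJ] cl ldl gp fr.
have lg : (l <= g)%N by rewrite -addnn (leq_trans lJ)// leq_addr.
have [|p0 [pp0 p0le prod]] := @produce R V A g fA g2 l _ p gp.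
  by rewrite leq_double.
have pp : (p < p0)%N by rewrite (leq_trans _ pp0)// -addn1 leq_add2l.
have p0J : (p0 <= 2 ^ J * p)%N.
  by rewrite (leq_trans p0le)// leq_mul2r leq_exp2l// lJ orbT.
have [|U U0 Up] := @exists_subset (cls lab 0) p0.
  by rewrite (leq_trans _ fr)// -addnn (leq_trans p0J)// leq_addr.
have [|W WU Wp] := @exists_subset (cls lab 0 :\: U) p0.
  have : (p0.*2 <= #|cls lab 0|)%N by rewrite (leq_trans _ fr)// leq_double.
  by rewrite cardsD (setIidPr U0) Up -addnn => h;
    rewrite leq_subRL// (leq_trans _ h)// leq_addr.
have [W0 UW] : W \subset cls lab 0 /\ [disjoint U & W].
  by move: WU; rewrite subsetD disjoint_sym => /andP[].
have [us pk _ _ _] := st.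
have UD : [disjoint U & cls lab g.+1] by exact: disjoint_cls U0 (subxx _) _.
have WD : [disjoint W & cls lab g.+1] by exact: disjoint_cls W0 (subxx _) _.
have UW0 : U :|: W \subset cls lab 0 by rewrite subUset U0.
have [s' [us' ss' res]] := prod _ _ _ _ _ us pk Up Wp UW UD WD.
exists s'; case: res => [[pk' gs']|[U' [W' [UU WW U'p W'p [pk' gs' lU lW]]]]].
  exists (relabel g lab U W set0 set0 0 0), (q + p0)%N.
  have clsE i : (1 <= i <= g)%N ->
      cls (relabel g lab U W set0 set0 0 0) i = cls lab i.
    move=> /andP[i1 ig]; rewrite cls_relabel ?sub0set// !if_same !setU0.
    by rewrite (cls_setD UW0)// eq_sym -lt0n.
  split=> //; last by left; rewrite clsE ?l1.
  - apply: (state_relabel g2 st UW U0 W0); rewrite ?sub0set ?setD0//.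
    by rewrite level_potential0 !mulr0 !subr0 !addr0.
  - by rewrite -[X in (X < _)%N]addn0 ltn_add2l (leq_trans _ pp).
  - by move=> i ig _; exact: clsE.
exists (relabel g lab U W U' W' l l), (q + (p0 - p))%N.
have clsE i : (1 <= i <= g)%N -> cls (relabel g lab U W U' W' l l) i =
    cls lab i :|: (if i == l then U' else set0) :|: (if i == l then W' else
      set0).
  move=> /andP[i1 ig]; rewrite cls_relabel//.
  by rewrite (cls_setD UW0)// eq_sym -lt0n.
split=> //.
- apply: (state_relabel g2 st UW U0 W0) => //.
  + by rewrite cardsD (setIidPr UU) Up U'p.
  + by rewrite cardsD (setIidPr WW) Wp W'p.
  + by rewrite level_potential0 U'p W'p; move: gs'; lra.
- by rewrite -[X in (X < _)%N]addn0 ltn_add2l subn_gt0.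
- by move=> i ig /negbTE il; rewrite clsE// il !setU0.
right; rewrite clsE ?l1// eqxx.
have U'0 := subset_trans UU U0; have W'0 := subset_trans WW W0.
have dU : [disjoint cls lab l & U'].
  by apply: disjoint_cls (subxx _) U'0 _; rewrite -lt0n.
have dW : [disjoint cls lab l & W'].
  by apply: disjoint_cls (subxx _) W'0 _; rewrite -lt0n.
have UW' : [disjoint U' & W'] by exact: disjointW UW.
have dUW : [disjoint cls lab l :|: U' & W'] by rewrite -setI_eq0 setIUl
  (disjoint_setI0 dW) (disjoint_setI0 UW') setU0.
split.
  rewrite cardsU (disjoint_setI0 dUW) cards0 cardsU (disjoint_setI0 dU) cards0.
  by rewrite !subn0 cl U'p W'p doubleD -addnA addnn.
have -> : (5 * l ^ 2 + 10 * l = 5 * l ^ 2 + 5 * l + 5 * l)%N.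
  by rewrite -addnA -mulnDl.
apply: loadedU => //; apply: loadedU => //.
exact: loaded_mono ldl.
Qed.

(* Between rounds: the nodes of level [l <= J] kept as future partners. *)
Definition rest s lab l := exists c, [/\ (c <= cohort (g.+1 - l - J))%N,
  #|cls lab l| = c.*2 & ld s (cls lab l) l (5 * l ^ 2)%N].

Definition idle s lab := (forall l, (1 <= l <= J)%N -> rest s lab l) /\
  (forall l, (J < l <= g)%N -> cls lab l = set0).

(** The sum of levels is [g - 1] rather than [g], so that partners raised to [g - i] are at the
    partner level of [i - 1] and can be reused. For [i = g - 1] and [i = g] the partners are fresh
    nodes. *)
Definition partner i := (g.-1 - i)%N.

(* During a round: the nodes that climb from level [J] to level [g] are at level
   [i]; the partners kept for them are described at the levels in [P]. *)
Definition climbing s lab i (P : pred nat) :=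
  [/\ (J <= i <= g)%N, #|cls lab i| = (cohort (i - J)).*2,
    ld s (cls lab i) i (5 * i.+1 ^ 2)%N,
    forall l, (1 <= l <= J)%N -> l != i -> P l -> rest s lab l &
    (forall l, (J < l <= g)%N -> l != i -> cls lab l = set0) /\
    ((J < i)%N -> (i < g)%N -> cls lab (g - i) = set0)].

Definition busy s lab i := climbing s lab i xpredT.

(** [predC1] exempts the partner class, which may exceed the bound of [rest] once topped up. At
    partner level 0, [W] is only a part of the fresh nodes. *)
Definition ready s lab i W := climbing s lab i (predC1 (partner i)) /\
  [/\ W \subset cls lab (partner i), #|W| = (cohort (i - J)).*2,
    ld s W (partner i) (5 * partner i ^ 2 + 10 * partner i)%N &
    (0 < partner i)%N -> W = cls lab (partner i)].

(** Partners kept from an earlier round have shrunk at least once more than the cohort they must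
    meet, so the number missing is large enough for [produce]. *)
Lemma cohort_drop k c : (k <= J)%N -> (c <= cohort k.+1)%N ->
  (3 * g * g <= cohort k - c)%N.
Proof.
move=> /cohort_divg; rewrite cohortS; have := leq_div (cohort k) g.
move: (cohort k) (cohort k %/ g)%N (3 * g * g)%N (5 * g.+1 ^ 2)%N => x y a b.
by clear; lia.
Qed.

Lemma cohort_le_n0 k : (cohort k <= n0)%N.
Proof. exact: (@cohort_anti 0). Qed.

Lemma rest_mono s s' lab lab' l : (forall v, load A s v <= load A s' v) ->
  cls lab' l = cls lab l -> rest s lab l -> rest s' lab' l.
Proof.
by move=> ss' E [c [c1 c2 c3]]; exists c; rewrite E; split=> //;
  exact: loaded_mono c3.
Qed.

Lemma rest_set0 s lab l : cls lab l = set0 -> rest s lab l.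
Proof. by move=> E; exists 0%N; rewrite E cards0; split=> //;
  exact: loaded_set0. Qed.

Lemma climbing_mono s s' lab lab' i (P : pred nat) :
  (forall v, load A s v <= load A s' v) ->
  (forall l, (1 <= l <= g)%N -> (l == i) || P l -> cls lab' l = cls lab l) ->
  (forall l, (J <= l)%N -> P l) -> ((i < g)%N -> P (g - i)%N) ->
  climbing s lab i P -> climbing s' lab' i P.
Proof.
move=> ss' E PJ Pgi [/andP[Ji ig] ci li ri [ei gi]].
have i1 : (1 <= i)%N by rewrite (leq_trans J1).
have Eii : cls lab' i = cls lab i by rewrite E ?i1 ?eqxx.
split; rewrite ?Eii ?Ji//.
- exact: loaded_mono li.
- move=> l /andP[l1 lJ] lni Pl; apply: rest_mono (ri l _ _ _) => //;
    last by rewrite l1.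
  by rewrite E ?Pl ?orbT// l1 (leq_trans lJ)// -addnn leq_addr.
split=> [l /andP[Jl lg] lni|Ji' ig'].
  rewrite E ?ei ?Jl ?lg//; last by rewrite PJ ?orbT// ltnW.
  by rewrite (leq_trans _ Jl).
by rewrite E ?gi ?Pgi ?orbT// subn_gt0 ig' leq_subr.
Qed.

(** Starts a round by completing class [J] to a full cohort. *)
Lemma fill_idle s lab q : state A g s lab q -> idle s lab ->
  ((2 ^ J * n0).*2 <= #|cls lab 0|)%N ->
  exists s' lab' q', [/\ state A g s' lab' q', (q < q')%N &
    idle s' lab' \/ busy s' lab' J].
Proof.
move=> st [re em] fr; have [|c [cJ cl ldl]] := re J; first by rewrite J1/=.
have Jg : (J <= g)%N by rewrite -addnn leq_addr.
have c1 : (c <= cohort 1)%N by rewrite (_ : 1%N = g.+1 - J - J)%N//; clear; lia.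
have p_large := cohort_drop (leq0n _) c1.
have [||s' [lab' [q' [st' ss' qq' E H]]]] := fill st _ cl ldl p_large.
- by rewrite J1/=.
- by rewrite (leq_trans _ fr)// leq_double leq_mul2l leq_subr orbT.
exists s', lab', q'; split=> //; case: H => [H|[H1 H2]].
  have E' l : (1 <= l <= g)%N -> cls lab' l = cls lab l.
    by move=> lg; have [->//|lJ] := eqVneq l J; exact: E.
  left; split=> l /andP[l1 l2].
    apply: rest_mono (re l _) => //; last by rewrite l1.
    by rewrite E'// l1 (leq_trans l2).
  by rewrite E' ?em ?l1 ?l2// (leq_trans _ l1).
right; split; rewrite ?leqnn ?Jg ?subnn//.
- rewrite H1; congr _.*2; rewrite subnKC//.
  exact: leq_trans c1 (cohort_anti (leq0n _)).
- by apply: loaded_mono H2 => //; clear; lia.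
- move=> l /andP[l1 l2] lJ _; apply: rest_mono (re l _) => //;
    last by rewrite l1.
  by rewrite E// l1 (leq_trans l2).
split=> [l /andP[l1 l2] lJ|]; last by rewrite ltnn.
by rewrite E ?em ?l1 ?l2// (leq_trans _ l1).
Qed.

(** A failed production is already offline progress, and the climb can be tried again from the same
    level. At partner level 0 nothing is produced, whence only [q <= q'] when ready. *)
Lemma fill_busy s lab q i : state A g s lab q -> busy s lab i ->
  ((2 ^ J * n0).*2 <= #|cls lab 0|)%N ->
  exists s' lab' q', [/\ state A g s' lab' q', (q <= q')%N &
    (q < q')%N /\ busy s' lab' i \/ exists W, ready s' lab' i W].
Proof.
move=> st bu fr; have [/andP[Ji ig] ci li ri [ei gi]] := bu.
have [us _ _ _ _] := st.
have [l0|l1] := posnP (partner i).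
  have [|W W0 Wc] := @exists_subset (cls lab 0) (cohort (i - J)).*2.
    rewrite (leq_trans _ fr)// leq_double (leq_trans (cohort_le_n0 _))//.
    by rewrite leq_pmull// expn_gt0.
  exists s, lab, q; split=> //; right; exists W; rewrite /ready l0; split.
      by split=> [|//|//|l l1 li' _|//]; [rewrite Ji|exact: ri].
  by split=> //; exact: loaded0.
set l := partner i in l1.
have il : (i.+2 <= g)%N by move: l1; rewrite /l /partner; clear; lia.
have lJ : (l < J)%N by rewrite /l /partner; clear -Ji J1; lia.
have li' : l != i by rewrite ltn_eqF// (leq_trans lJ).
have [|c [cJ cl ldl]] := ri l _ li' isT; first by rewrite l1 ltnW.
have c1 : (c <= cohort (i - J).+1)%N.
  rewrite (leq_trans cJ)// cohort_anti// /l /partner; clear -il Ji; lia.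
have p_large : (3 * g * g <= cohort (i - J) - c)%N by apply: cohort_drop => //;
  clear -ig; lia.
have [||s' [lab' [q' [st' ss' qq' E H]]]] := fill st _ cl ldl p_large.
- by rewrite l1 ltnW.
- rewrite (leq_trans _ fr)// leq_double leq_mul2l (leq_trans (leq_subr _ _))
    ?orbT//.
  exact: cohort_le_n0.
exists s', lab', q'; split=> //; first exact: ltnW.
case: H => [H|[H1 H2]].
  left; split=> //; apply: climbing_mono bu => // k kg _.
  by have [->//|kl] := eqVneq k l; exact: E.
right; exists (cls lab' l); split.
  have : climbing s lab i (predC1 l).
    by split=> [|//|//|k k1 ki _|//]; [rewrite Ji|exact: ri].
  apply: climbing_mono => //.
  - by move=> k kg /orP[/eqP->|kl]; apply: E => //;
      rewrite ?(leq_trans J1 Ji) ?ig// eq_sym.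
  - by move=> k Jk; rewrite /= gtn_eqF// (leq_trans lJ).
  - by move=> ig' /=; rewrite /l /partner; clear -ig'; lia.
split=> //; rewrite H1; congr _.*2; rewrite subnKC//.
exact: leq_trans c1 (cohort_anti (leqnSn _)).
Qed.

(* Past the last level the nodes would be loaded beyond 1. *)
Lemma overload s B : two_uniform s -> (cohort J <= #|B|)%N ->
  ~ ld s B g.+1 (5 * g.+1 ^ 2 + 5)%N.
Proof.
move=> us Bk; rewrite /loaded => h.
have : \sum_(v in B) load A s v <= #|B|%:R.
  by rewrite -sumr_const; apply: ler_sum => v _; exact: feasible_load.
have g0 : 0 < g%:R :> R by rewrite ltr0n (leq_trans _ g2).
have : (5 * g.+1 ^ 2 + 6)%:R <= #|B|%:R / g%:R :> R.
  rewrite ler_pdivlMr// -natrM ler_nat (leq_trans _ Bk)//.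
  rewrite (leq_trans _ (cohort_large (leqnn J)))// mulnC leq_mul2l.
  by rewrite -addnA leq_addl orbT.
have -> : (5 * g.+1 ^ 2 + 6)%:R = (5 * g.+1 ^ 2 + 5)%:R + 1 :> R.
  by rewrite natr1 -addnS.
move: h; rewrite levelS /level divff ?gt_eqF// mulrDr mulr1.
by lra.
Qed.

(** If all pairs of the phase are matched, the round is over and the remaining classes are idle.
    Otherwise the cohort climbs one level, which [overload] forbids at [i = g]. *)
Lemma step_ready s lab q i W : state A g s lab q -> ready s lab i W ->
  exists s' lab' q', [/\ state A g s' lab' q', (q < q')%N &
    idle s' lab' \/ busy s' lab' i.+1].
Proof.
move=> st [[/andP[Ji ig] ci li ri [ei gi]] [W0 Wc lW W1]].
set l := partner i in W0 lW W1 ri.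
have [us pk _ _ _] := st.
have lJ : (l < J)%N by rewrite /l /partner; clear -Ji J1; lia.
have Jg : (J <= g)%N by rewrite -addnn leq_addr.
have lg : (l <= g)%N by rewrite (leq_trans (ltnW lJ)).
have li' : l != i by rewrite ltn_eqF// (leq_trans lJ).
have il_g : (i + l <= g)%N by rewrite /l /partner; clear -ig; lia.
have kJ : (i - J <= J)%N by clear -ig; lia.
have i1 : (1 <= i)%N by rewrite (leq_trans J1).
set k := (i - J)%N in ci Wc kJ.
have UW : [disjoint cls lab i & W] by apply: disjoint_cls (subxx _) W0 _;
  rewrite eq_sym.
have UD : [disjoint cls lab i & cls lab g.+1].
  by apply: disjoint_cls (subxx _) (subxx _) _; rewrite ltn_eqF.
have WD : [disjoint W & cls lab g.+1].
  by apply: disjoint_cls W0 (subxx _) _; rewrite ltn_eqF.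
(* Not [(cohort k).*2 %/ g]: this choice leaves exactly [(cohort k.+1).*2] survivors. *)
pose m := (cohort k %/ g).*2.
have mn : (m * g <= (cohort k).*2)%N by rewrite /m -doubleMl leq_double
  leq_divM.
have nm : ((cohort k).*2 <= (m + 2) * g)%N.
  rewrite /m (_ : _ + 2 = (cohort k %/ g).+1.*2)%N;
    last by rewrite doubleS addn2.
  by rewrite -doubleMl leq_double ltnW// ltn_ceil// (leq_trans _ g2).
have gm : (3 * g <= m)%N.
  have h := cohort_divg kJ; rewrite /m.
  have : (3 * g <= 3 * g * g)%N by rewrite leq_pmulr// (leq_trans _ g2).
  by move: h; clear; move: (3 * g * g)%N (5 * g.+1 ^ 2)%N (cohort k %/ g)%N (3
    * g)%N; lia.
have n_gt0 : (0 < (cohort k).*2)%N.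
  have := cohort_large kJ; rewrite double_gt0; apply: leq_trans.
  by rewrite muln_gt0 (leq_trans _ g2)//= addnS.
have nmE : ((cohort k).*2 - m = (cohort k.+1).*2)%N by rewrite /m -doubleB.
have UUW : cls lab i :|: W \subset cls lab i :|: cls lab l by exact: setUS.
have clsE (U' W' : {set V}) x y j : U' \subset cls lab i -> W' \subset W ->
    (1 <= j <= g)%N -> cls (relabel g lab (cls lab i) W U' W' x y) j =
    (if (j == i) || (j == l) then set0 else cls lab j)
    :|: (if j == x then U' else set0) :|: (if j == y then W' else set0).
  move=> UU WW /andP[j1 jg]; rewrite cls_relabel//; congr (_ :|: _ :|: _).
  have [->/=|ji] := eqVneq j i; first by apply/eqP; rewrite setD_eq0 subsetUl.
  rewrite setDUr (_ : _ :\: cls lab i = cls lab j); last first.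
    by apply: cls_setD (subxx _) _; rewrite eq_sym.
  have [jl|jl] /= := eqVneq j l; last first.
    by rewrite (cls_setD W0) 1?eq_sym// setIid.
  by rewrite jl -W1 -?jl// setDv setI0.
have [s' [us' ss' [[pk' gs']|]]] := phase fA g2 us pk ci Wc UW UD WD mn nm gm
  il_g li lW.
  exists s', (relabel g lab (cls lab i) W set0 set0 0 0), (q + (cohort k).*2)%N.
  split; last 1 first.
  - left; split=> [j /andP[j1 jJ]|j /andP[Jj jg]].
      have jg : (j <= g)%N by rewrite (leq_trans jJ).
      have := clsE set0 set0 0 0 j (sub0set _) (sub0set _).
      rewrite j1 jg !if_same !setU0 => /(_ isT).
      case: ifPn => [_|/norP[ji jl]] E; first exact: rest_set0.
      by apply: rest_mono E (ri j _ _ _) => //; rewrite j1.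
    rewrite clsE ?sub0set// ?jg ?(leq_trans _ Jj)// !if_same !setU0.
    by case: ifPn => // /norP[ji jl]; rewrite ei ?Jj.
  - apply: (state_relabel g2 st UW (subxx _) W0);
      rewrite ?sub0set ?setD0 ?cards0//.
    by rewrite ci Wc; move: gs'; lra.
  - by rewrite -[X in (X < _)%N]addn0 ltn_add2l.
move=> [U' [W' [UU WW U'c W'c [pk' gs' lU lW']]]].
have [ig'|gi'] := ltnP i g; last first.
  have iE : i = g by apply/eqP; rewrite eqn_leq ig.
  exfalso; apply: (@overload s' U') => //.
    rewrite U'c nmE; have := leq_double_shrink g2 (cohort k).
    rewrite -/(cohort k.+1) mul2n; apply: leq_trans.
    by rewrite cohort_anti.
  by move: lU; rewrite iE.
have Eq : (q < q + m)%N by rewrite -[X in (X < _)%N]addn0 ltn_add2l (leq_trans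
  _ gm)// muln_gt0/= (leq_trans _ g2).
have lS : l.+1 = (g - i)%N by rewrite /l /partner; clear -ig'; lia.
have lSJ : (l.+1 <= J)%N by [].
have iSl : i.+1 != l.+1 by rewrite eqSS eq_sym.
have clsiS : cls lab i.+1 = set0 by apply: ei; rewrite ?ltnS ?Ji// gtn_eqF.
(* The raised partners need an empty class: level [l.+1 = g - i] held the partners of the previous
   phase and was used up. The exception [l.+1 = i] occurs at [i = J], where the climbing class
   itself is being vacated. *)
have clslS : l.+1 != i -> cls lab l.+1 = set0.
  move=> li2; rewrite lS gi//; move: li2; rewrite lS; clear -Ji ig'; lia.
exists s', (relabel g lab (cls lab i) W U' W' i.+1 l.+1), (q + m)%N; split=> //.
  apply: (state_relabel g2 st UW (subxx _) W0) => //.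
  - by rewrite (leq_trans lSJ).
  - by rewrite cardsD (setIidPr UU) ci U'c subKn// (leq_trans _ mn)//
      leq_pmulr// (leq_trans _ g2).
  - by rewrite cardsD (setIidPr WW) Wc W'c subKn// (leq_trans _ mn)//
      leq_pmulr// (leq_trans _ g2).
  - by rewrite ci Wc U'c W'c; move: gs'; lra.
right.
have E j : (1 <= j <= g)%N -> cls (relabel g lab (cls lab i) W U' W' i.+1 l.+1)
  j =
    if j == i.+1 then U' else if j == l.+1 then W' else
    if (j == i) || (j == l) then set0 else cls lab j.
  move=> jg; rewrite clsE//; have [->|jiS] := eqVneq j i.+1.
    rewrite (negbTE iSl) setU0 [i.+1 == i]gtn_eqF// gtn_eqF; last first.
      by rewrite (leq_trans lJ)// (leq_trans Ji).
    by rewrite clsiS set0U.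
  rewrite setU0; have [->|_] := eqVneq j l.+1; last by rewrite setU0.
  rewrite [l.+1 == l]gtn_eqF// orbF; case: ifPn => [_|/clslS->];
    by rewrite set0U.
have kS : (i.+1 - J = k.+1)%N by rewrite subSn.
split.
- by rewrite ig' (leq_trans Ji).
- by rewrite E ?eqxx// U'c nmE kS.
- rewrite E ?eqxx//; apply: loaded_mono lU => //.
  by clear; lia.
- move=> j /andP[j1 jJ] jiS _; have jg : (1 <= j <=
    g)%N by rewrite j1 (leq_trans jJ).
  have := E j jg; rewrite (negbTE jiS); case: eqP => [->|_].
    move=> El; exists (cohort k.+1); rewrite El W'c nmE; split=> //.
      by apply: cohort_anti; rewrite -kS lS; clear -ig'; lia.
    (* [5 l^2 + 10 l + 5 = 5 (l + 1)^2], which is why [rest] allows a quadratic error. *)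
    by apply: loaded_mono lW' => //; clear; lia.
  case: ifPn => [_|/norP[ji jl]] Ej; first exact: rest_set0.
  by apply: rest_mono Ej (ri j _ _ _) => //; rewrite j1.
split=> [j /andP[Jj jg] jiS|Ji' iSg].
  rewrite E ?jg ?(leq_trans _ Jj)// (negbTE jiS) gtn_eqF ?(leq_ltn_trans lSJ)//.
  by case: ifPn => // /norP[ji jl]; rewrite ei ?Jj.
have -> : (g - i.+1 = l)%N by rewrite subnS -lS.
have l1 : (0 < l)%N by rewrite /l /partner; clear -iSg; lia.
by rewrite E ?l1// ltn_eqF 1?ltn_eqF ?eqxx ?orbT// (leq_trans lJ)//
  (leq_trans Ji).
Qed.

End Strategy.

(** * Upper bound on the competitive ratio *)

Section Adversary.
Variables (R : realType) (A : algorithm R) (J : nat).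
Hypotheses (fA : feasible A) (J1 : (1 <= J)%N).
Local Notation g := (J.*2).

Let g2 : (2 <= g)%N. Proof. by rewrite -addnn (leq_add J1 J1). Qed.

(** A cohort at most halves at each level, so the factor [2 ^ J] leaves enough after [J] levels. *)
Let n0 := (2 ^ J * (g * (3 * g * g + 5 * g.+1 ^ 2 + 6)))%N.
(** The potential never exceeds [g * n0.*2], which is at most [q / g] once [q] reaches this
    value. *)
Let target := (g * g * n0.*2)%N.
(** Room for the nodes matched while [q < target], for [g] classes of at most [n0.*2] nodes, and for
    the fresh nodes of one more production. *)
Let V : finType := 'I_(target.*2 + g * n0.*2 + (2 ^ J * n0).*2).

Lemma cohort_large k : (k <= J)%N ->
  (g * (3 * g * g + 5 * g.+1 ^ 2 + 6) <= cohort J n0 k)%N.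
Proof.
move=> kJ; have n0_le : (n0 <= 2 ^ k * cohort J n0 k)%N.
  elim: k {kJ} => [|k IH]; first by rewrite mul1n.
  rewrite (leq_trans IH)// expnSr -mulnA leq_mul2l leq_double_shrink ?orbT//.
rewrite -(@leq_pmul2l (2 ^ J)) ?expn_gt0//; apply: leq_trans n0_le _.
by rewrite leq_mul2r leq_exp2l// kJ orbT.
Qed.

Definition reached s (lab : V -> nat) q := state A g s lab q /\
  (idle A J n0 s lab \/ exists i, busy A J n0 s lab i).

Lemma reached_small s lab q : reached s lab q ->
  forall i, (1 <= i <= g)%N -> (#|cls lab i| <= n0.*2)%N.
Proof.
have small l : rest A J n0 s lab l -> (#|cls lab l| <= n0.*2)%N.
  by move=> [c [cc -> _]]; rewrite leq_double (leq_trans cc)// cohort_le_n0.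
move=> [_ [[re em]|[k [_ ck _ re [em _]]]]] i /andP[i1 ig].
  have [iJ|Ji] := leqP i J; first by apply/small/re; rewrite i1.
  by rewrite em ?Ji// cards0.
have [->|ik] := eqVneq i k; first by rewrite ck leq_double cohort_le_n0.
have [iJ|Ji] := leqP i J; first by apply/small/re; rewrite ?i1.
by rewrite em ?Ji// cards0.
Qed.

Lemma reached_next s lab q : reached s lab q -> (q < target)%N ->
  exists s' lab' q', reached s' lab' q' /\ (q < q')%N.
Proof.
move=> /[dup] re [st ib] qt.
have fr : ((2 ^ J * n0).*2 <= #|cls lab 0|)%N.
  have := card_fresh st (reached_small re); rewrite card_ord.
  move: qt; move: (g * n0.*2)%N (2 ^ J * n0)%N target #|cls lab 0| => a b c d.
  by clear; lia.
case: ib => [id|[i bu]].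
  have [s' [lab' [q' [st' qq' H]]]] := fill_idle fA J1 cohort_large st id fr.
  exists s', lab', q'; split=> //; split=> //.
  by case: H => [?|?]; [left|right; exists J].
have [s' [lab' [q' [st' qq' [[lt_q bu']|[W rd]]]]]] :=
    fill_busy fA J1 cohort_large st bu fr.
  by exists s', lab', q'; split=> //; split=> //; right; exists i.
have [s2 [lab2 [q2 [st2 qq2 H]]]] := step_ready fA J1 cohort_large st' rd.
exists s2, lab2, q2; split; last exact: leq_ltn_trans qq2.
by split=> //; case: H => [?|?]; [left|right; exists i.+1].
Qed.

Lemma reached_target : exists s lab q, reached s lab q /\ (target <= q)%N.
Proof.
suff H k : exists s lab q, reached s lab q /\ (minn k target <= q)%N.
  by have [s [lab [q]]] := H target; rewrite minnn; exists s, lab, q.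
elim: k => [|k [s [lab [q [re kq]]]]].
  have cls0 i : (0 < i)%N -> cls (fun=> 0%N : nat) i = set0 :> {set V}.
    by move=> i0; apply/setP => v; rewrite !inE ltn_eqF.
  exists [::], (fun=> 0%N), 0%N; split; last by rewrite min0n.
  split.
    split=> //; rewrite ?cls0 ?cards0//; first exact: packing_nil.
    rewrite /gained /edge_sum big_ord0 mulr0 add0r big1// => v _.
    by rewrite /label_potential/= level_potential0.
  left; split=> l /andP[l1 _]; last by rewrite cls0// (leq_trans _ l1).
  by apply: rest_set0; rewrite cls0.
have [tq|qt] := leqP target q.
  by exists s, lab, q; split=> //; rewrite (leq_trans (geq_minr _ _)).
have [s' [lab' [q' [re' qq']]]] := reached_next re qt.
exists s', lab', q'; split=> //; rewrite (leq_trans _ qq')//.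
by move: kq qt; clear; lia.
Qed.

(** At the target, [rho * q] is at most the value, itself at most [ratio_eps * q] plus the
    potential; the latter adds [1 / g] to the [5 / g] of [ratio_eps]. *)
Lemma competitive_le_eps rho : competitive rho A ->
  rho <= opt_ratio R + 6 / g%:R.
Proof.
move=> cA; have g0 : 0 < g%:R :> R by rewrite ltr0n (leq_trans _ g2).
have r0 := opt_ratio_gt0 R.
have [rho0|rho0] := leP rho 0.
  by rewrite (le_trans rho0)// addr_ge0 ?divr_ge0// ltW.
have [s [lab [q [re tq]]]] := reached_target.
have [st _] := re; have [us pk _ gs _] := st.
have := cA _ _ (list_hypergraph us).
rewrite weight_run arrivals_list_hypergraph => /le_trans/(_ gs) h.
have qO := packing_le_OPT us pk.
have := label_potential_le g2 st (reached_small re) => pot.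
have qg : (g * n0.*2)%:R <= q%:R / g%:R :> R.
  by rewrite ler_pdivlMr// -natrM ler_nat mulnAC.
have q0 : 0 < q%:R :> R.
  rewrite ltr0n; apply: leq_trans tq.
  by rewrite /target /n0 !(muln_gt0, double_gt0, expn_gt0)/= J1/= addnS.
rewrite -(ler_pM2r q0); apply: le_trans (_ : rho * OPT_LP R (list_hypergraph
  us) <= _).
  by rewrite ler_wpM2l// ltW.
apply: le_trans h _; rewrite /ratio_eps.
have -> : (opt_ratio R + 6 / g%:R) * q%:R =
  (opt_ratio R + 5 / g%:R) * q%:R + q%:R / g%:R by ring.
by rewrite lerD2l (le_trans pot).
Qed.

End Adversary.

Lemma competitive_le (R : realType) (rho : R) (A : algorithm R) :
  feasible A -> competitive rho A -> rho <= opt_ratio R.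
Proof.
move=> fA cA; apply/ler_addgt0Pr => e e0.
(* [J > 3 / e] gives [6 / g = 3 / J < e]. *)
have := truncnS_gt (3 / e); set J := (Num.truncn (3 / e)).+1 => eJ.
have := @competitive_le_eps R A J fA isT rho cA => /le_trans; apply.
rewrite lerD2l -muln2 natrM ler_pdivrMr ?mulr_gt0// ?ltr0n//.
by move: eJ; rewrite ltr_pdivrMr//; lra.
Qed.

(** * Reduction of randomized algorithms to deterministic ones *)

Section Randomized.
Variables (R : realType) (d : measure_display) (T : measurableType d).
Variables (P : probability T R) (A : T -> algorithm R).
Hypotheses (fA : forall omega, feasible (A omega)).
Hypothesis mA : measurable_decisions A.

(** Expected decisions still depend only on the history; the constraints and the value are linear,
    so feasibility and value pass to the mean. *)
Definition mean_algorithm : algorithm R :=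
  fun V s e => fine ('E_P[fun omega => @A omega V s e]).

Lemma expectationE (X : T -> R) :
  ('E_P[X] = \int[P]_omega (X omega)%:E)%E.
Proof. by rewrite unlock. Qed.

Section Instance.
Variables (V : finType) (m : nat) (H : hypergraph V m).

Lemma run_ge0 omega h : h \in hyperedges H -> 0 <= run (A omega) H h.
Proof. by move=> hH; apply: (fA omega H).1. Qed.

Lemma run_le1 omega h : h \in hyperedges H -> run (A omega) H h <= 1.
Proof.
move=> hH; have [A0 A1] := fA omega H.
apply: le_trans (A1 (inr h.1)); rewrite (bigD1 h)/=; last by rewrite inE hH/=.
rewrite lerDl sumr_ge0// => k; rewrite inE => /andP[/andP[kH _] _].
exact: A0.
Qed.

Lemma integrable_run h : h \in hyperedges H ->
  P.-integrable [set: T]%classic (EFin \o (fun omega => run (A omega) H h)).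
Proof.
move=> hH; apply: measurable_bounded_integrable => //.
- by rewrite (le_lt_trans (probability_le1 P measurableT))// ltry.
- exact: mA.
exists 1; split=> // M M1 omega _ /=.
by rewrite ger0_norm ?run_ge0// (le_trans (run_le1 _ hH))// ltW.
Qed.

Lemma run_mean h : run mean_algorithm H h =
  fine ('E_P[fun omega => run (A omega) H h]).
Proof. by []. Qed.

(** Measurability is assumed only on hyperedges; the value 0 elsewhere makes every term integrable,
    as [integral_sum] requires. *)
Let decide h omega := if h \in hyperedges H then run (A omega) H h else 0.

Let integrable_decide h : P.-integrable [set: T]%classic (EFin \o decide h).
Proof.
rewrite /decide; have [hH|_] := boolP (h \in hyperedges H).
  exact: integrable_run.
exact: integrable0.
Qed.

Let sum_decide (Q : pred ('I_m * {set V})) :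
  (fun omega => \sum_(h in hyperedges H | Q h) run (A omega) H h) =
  (fun omega => \sum_(h in hyperedges H | Q h) decide h omega).
Proof.
apply/funext => omega; apply: eq_bigr => h /andP[hH _].
by rewrite /decide hH.
Qed.

Lemma sum_run_mean (Q : pred ('I_m * {set V})) :
  ((\sum_(h in hyperedges H | Q h) run mean_algorithm H h)%R%:E =
  'E_P[fun omega => (\sum_(h in hyperedges H | Q h) run (A omega) H h)%R])%E.
Proof.
rewrite sum_decide -sumEFin expectationE.
under [in RHS]eq_integral do rewrite -sumEFin.
rewrite (integral_sum measurableT integrable_decide).
apply: eq_bigr => h /andP[hH _]; rewrite run_mean expectationE fineK.
  by apply: eq_integral => omega _; rewrite /= /decide hH.
exact: integrable_fin_num (integrable_run hH).
Qed.

Lemma sum_run_mean_le1 (Q : pred ('I_m * {set V})) :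
  (forall omega, \sum_(h in hyperedges H | Q h) run (A omega) H h <= 1) ->
  \sum_(h in hyperedges H | Q h) run mean_algorithm H h <= 1.
Proof.
move=> A1; rewrite -lee_fin sum_run_mean.
have -> : 1%:E = (\int[P]_omega (cst 1 omega))%E.
  by rewrite integral_cst//= probability_setT mule1.
rewrite expectationE; apply: ge0_le_integral => //.
- move=> omega _; rewrite lee_fin sumr_ge0// => h /andP[hH _].
  exact: run_ge0.
- apply/measurable_realfun.measurable_EFinP; rewrite sum_decide.
  under eq_fun do rewrite -big_filter.
  apply: measurable_sum => h.
  by have /measurable_int/measurable_realfun.measurable_EFinP :=
    integrable_decide h.
- by move=> omega _; rewrite lee_fin.
Qed.

End Instance.

Lemma feasible_mean : feasible mean_algorithm.
Proof.
move=> V m H; split=> [h hH|v].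
  rewrite run_mean fine_ge0// expectationE integral_ge0// => omega _.
  by rewrite lee_fin run_ge0.
under eq_bigl do rewrite inE.
apply: sum_run_mean_le1 => omega; have [_ /(_ v)] := fA omega H.
by under eq_bigl do rewrite inE.
Qed.

Lemma competitive_mean (rho : R) :
  competitive_in_expectation P rho A -> competitive rho mean_algorithm.
Proof.
move=> cA V m H; rewrite -lee_fin; apply: le_trans (cA V m H) _.
have weightE B : value B H = \sum_(h in hyperedges H | true) run B H h.
  by apply: eq_bigl => h; rewrite andbT.
by rewrite weightE sum_run_mean; under eq_fun do rewrite weightE.
Qed.

End Randomized.

Theorem theorem1p1 (R : realType) :
  (exists A : algorithm R,
      feasible A /\ competitive ((expR 1 - 1) / (expR 1 + 1)) A) /\
  (forall (rho : R) (A : algorithm R),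
      feasible A -> competitive rho A ->
      rho <= (expR 1 - 1) / (expR 1 + 1)) /\
  (forall (d : measure_display) (T : measurableType d) (P : probability T R)
      (rho : R) (A : T -> algorithm R),
      (forall omega : T, feasible (A omega)) -> measurable_decisions A ->
      competitive_in_expectation P rho A ->
      rho <= (expR 1 - 1) / (expR 1 + 1)).
Proof.
split; first by exists (water_filling R); split;
  [exact: water_filling_feasible|exact: water_filling_competitive].
split=> [rho A fA cA|d T P rho A fA mA cA].
  exact: (competitive_le fA cA).
exact: (competitive_le (feasible_mean P fA mA) (competitive_mean fA mA cA)).
Qed.
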